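(* Suppose that $\ell=p$. If $v(c)=-p/(p-1)$, then there exists $w\in\mathbb{R}_{\ge0}$ such that the upper numbering ramification group $G(\infty)^w$ is trivial.
   Context: $p$ is a prime, $K$ is a finite extension of $\mathbb{Q}_p$ with valuation $v$ normalized by $v(p)=1$ and extended to an algebraic closure $\overline{K}$; $f(z)=z^p-c$ with $c\in K^\times$ (i.e. $\ell=p$ is the degree of $f$). $f^n$ is the $n$-th iterate of $f$; $a\in K$ is such that for every $n\ge0$ the solutions of $f^n(z)=a$ in $\overline{K}$ are distinct; $f^{-n}(a)$ is the set of these solutions; $K_n=K(f^{-n}(a))$; $K_\infty=\bigcup_{n\ge1}K_n$; $G(\infty)=\mathrm{Gal}(K_\infty/K)$. Ramification groups: for a finite Galois extension $L/K$ with group $G$, let $v_L\colon L\to\mathbb{Z}\cup\{\infty\}$ be the surjective normalized discrete valuation and $\mathcal{O}_L=\{x\in L:v_L(x)\ge0\}$. For $u\in\mathbb{R}_{\ge0}$, $G_u=\{\sigma\in G: v_L(\sigma x-x)\ge u+1\text{ for all }x\in\mathcal{O}_L\}$. Let $\phi_{L/K}(u)=\int_0^u\frac{dt}{(G_0:G_t)}$, a bijection $\mathbb{R}_{\ge0}\to\mathbb{R}_{\ge0}$, and define $G^w$ for $w\in\mathbb{R}_{\ge0}$ by $G^{\phi_{L/K}(u)}=G_u$. For an infinite Galois extension $L/K$ with group $G$, $G^w=\varprojlim\mathrm{Gal}(L'/K)^w$ over the finite Galois extensions $L'$ of $K$ contained in $L$. *)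

(* Defs.v *)
From HB Require Import structures.
From mathcomp Require Import all_boot all_order all_fingroup all_algebra all_field.
From mathcomp Require Import all_classical all_reals all_analysis.

Set Implicit Arguments.
Unset Strict Implicit.
Unset Printing Implicit Defensive.

Import Order.TTheory GRing.Theory Num.Theory.
Import numFieldNormedType.Exports.

Local Open Scope classical_set_scope.
Local Open Scope ring_scope.

Section Valuations.
Variable R : realType.

Definition valuation (F : fieldType) (v : F -> \bar R) : Prop :=
  [/\ forall x, (v x = +oo)%E <-> x = 0,
      forall x, (v x != -oo)%E,
      forall x y, v (x * y)%R = (v x + v y)%E
    & forall x y, (Order.min (v x) (v y) <= v (x + y)%R)%E].

Definition padic_val (p : nat) (q : rat) : \bar R :=
  if q == 0 then +oo%E
  else ((logn p `|numq q|%N)%:R - (logn p `|denq q|%N)%:R)%:E.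

Definition val_cauchy (F : fieldType) (v : F -> \bar R) (u : nat -> F) : Prop :=
  forall M : R, exists N : nat, forall m n : nat, (N <= m)%N -> (N <= n)%N ->
    (M%:E <= v (u m - u n)%R)%E.

Definition val_cvg (F : fieldType) (v : F -> \bar R) (u : nat -> F) (l : F) :
    Prop :=
  forall M : R, exists N : nat, forall n : nat, (N <= n)%N ->
    (M%:E <= v (u n - l)%R)%E.

(* [F] with [v] is the field Q_p: it is the completion of Q with respect to
   the p-adic valuation. *)
Definition padic_completion (p : nat) (F : fieldType) (v : F -> \bar R) :
    Prop :=
  [/\ valuation v,
      forall q : rat, v (ratr q) = padic_val p q,
      forall (x : F) (M : R), exists q : rat, (M%:E <= v (x - ratr q)%R)%E
    & forall u : nat -> F, val_cauchy v u -> exists l : F, val_cvg v u l].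

(* The discrete valuations whose value group is exactly Z.  A finite extension
   of Q_p has exactly one of them. *)
Definition normalized_valuation (L : fieldType) (v : L -> \bar R) : Prop :=
  valuation v /\
  v @` [set x | x != 0] = range (fun k : int => (k%:~R : R)%:E).

End Valuations.

Section Ramification.
Variables (R : realType) (F : fieldType) (L : splittingFieldType F).
Variable vL : L -> \bar R.

Definition lower_ramif (u : R) : {set gal_of {:L}} :=
  [set s in galoisG {:L} 1 |
     `[< forall x : L, (0 <= vL x)%E -> ((u + 1)%:E <= vL (s x - x)%R)%E >] ]%SET.

Definition herbrand (u : R) : R :=
  \int[lebesgue_measure]_(t in `[0, u])
     (#|lower_ramif 0 : lower_ramif t|%g%:R)^-1.

(* As [herbrand] is a bijection of the nonnegative reals, exactly one [u]
   contributes. *)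
Definition upper_ramif (w : R) : {set gal_of {:L}} :=
  [set s | `[< exists u : R,
                 [/\ 0 <= u, herbrand u = w & s \in lower_ramif u] >] ]%SET.

End Ramification.

Definition algebraic_closure (K : fieldType) (Kbar : closedFieldType)
    (iota : {rmorphism K -> Kbar}) : Prop :=
  forall x : Kbar, algebraicOver iota x.

(* A finite Galois extension of [K] contained in the subset [E] of [Kbar],
   given together with its embedding. *)
Record finGaloisSub (K : fieldType) (Kbar : closedFieldType)
    (iota : {rmorphism K -> Kbar}) (E : set Kbar) := FinGaloisSub {
  fgs_field :> splittingFieldType K;
  fgs_galois : galois 1 {:fgs_field};
  fgs_emb : {rmorphism fgs_field -> Kbar};
  fgs_embK : forall k : K, fgs_emb (k%:A) = iota k;
  fgs_sub : range fgs_emb `<=` E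
}.

Section InverseLimit.
Variables (R : realType) (K : fieldType) (Kbar : closedFieldType).
Variables (iota : {rmorphism K -> Kbar}) (E : set Kbar).

Definition gal_family := forall M : finGaloisSub iota E, gal_of {:M}.

(* When M is contained in N, the restriction of [s N] to M is [s M]. *)
Definition gal_compatible (s : gal_family) : Prop :=
  forall M N : finGaloisSub iota E,
    range (fgs_emb M) `<=` range (fgs_emb N) ->
    forall (x : M) (y : N), fgs_emb M x = fgs_emb N y ->
      fgs_emb M (s M x) = fgs_emb N (s N y).

(* The inverse limit of the groups Gal(M / K)^w.  It is a predicate, not a
   [set], because [gal_family] is too large a type for [set]. *)
Definition upper_ramif_lim (w : R) (s : gal_family) : Prop :=
  gal_compatible s /\
  forall (M : finGaloisSub iota E) (vM : M -> \bar R),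
    normalized_valuation vM -> s M \in upper_ramif vM w.

Definition upper_ramif_lim_trivial (w : R) : Prop :=
  forall s : gal_family,
    upper_ramif_lim w s <-> (forall M : finGaloisSub iota E, s M = 1%g).

End InverseLimit.

Section Arboreal.
Variables (K : fieldType) (Kbar : closedFieldType).
Variables (iota : {rmorphism K -> Kbar}) (f : {poly K}) (a : K).

Definition iter_poly (n : nat) : {poly K} := iter n (fun q => f \Po q) 'X.

Definition preimages (n : nat) : set Kbar :=
  [set z | (map_poly iota (iter_poly n)).[z] = iota a].

Definition distinct_solutions (n : nat) : Prop :=
  exists2 s : seq Kbar, uniq s
    & map_poly iota (iter_poly n - a%:P) =
      lead_coef (map_poly iota (iter_poly n - a%:P)) *:
        \prod_(z <- s) ('X - z%:P).

Definition adjoin_set (A : set Kbar) : set Kbar :=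
  smallest (fun S : set Kbar => GRing.divring_closed (fun z => z \in S))
           (range iota `|` A).

Definition preimage_field (n : nat) : set Kbar := adjoin_set (preimages n).

Definition preimage_field_infty : set Kbar :=
  \bigcup_(n in [set n | (1 <= n)%N]) preimage_field n.

End Arboreal.

(* Main.v *)
Require Import Defs.
From HB Require Import structures.
From mathcomp Require Import all_boot all_order all_fingroup all_algebra all_field.
From mathcomp Require Import all_classical all_reals all_analysis.
From mathcomp Require Import ring lra zify.
From mathcomp Require Import measurable_realfun.

(** Write [f z = z ^ p - c].  Since [v c = - p / (p - 1)], every vertex [z] of a deep
    level of the tree of preimages of [a] has [v z = - 1 / (p - 1)], and there the
    derivative of [f] is a unit: [f (z + d) - f z] is a polynomial in [d] with
    integral coefficients, unit linear coefficient and leading term [d ^ p].  Two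
    consequences drive the proof.  Distinct preimages of one point are at distance
    of valuation exactly [0] ([siblings_dist]), and negative distances are divided
    by [p] from one level to the next ([child_dist]).

    Let [L] be a finite level of the tower, [w] its normalized valuation, [E] the
    value of [w p], [pi] a uniformizer and [G0] the inertia group.  For integral
    [y != y'], the sum of [w (s pi - pi)] over the [s] in [G0] with [s y = y'] is at
    most [w (y' - y)] ([inertia_sum_le]).  So it is enough to find pairs of integral
    elements, with a total distance (for [v]) bounded by some [B] independent of the
    level, such that each nontrivial [s] in [G0] maps the first member of some pair
    to the second.  Such pairs come from finitely many branches of the tree
    ([moved_pairs]): along a branch [z_k] the inverses of [z_(k+1) - z_k] and of
    [z' - z_k], with [z'] a sibling of [z_(k+1)], are at a distance that decreases
    geometrically with [k]; inertia cannot move the vertices away from the branches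
    when it fixes these, because a nontrivial move between siblings would be visible
    in the residue field.

    The Herbrand function at [u] is the average over [G0] of the length of the part
    of [[0, u]] where an element stays in the ramification groups.  If [u] is at most
    the last break, the pairs bound both [u] and the sum of the [w (s pi - pi)] by
    [E * B], so the value at [u] is at most [2 * E * B / #|G0|] ([herbrand_le]).
    Finally [E] is at most [[K : Q_p]!] times [#|G0|], because some element of [K]
    has value [#|G0|] for [w] ([card_inertia_value]).  Hence no nontrivial element of
    any level survives in the upper numbering beyond [2 * [K : Q_p]! * B], uniformly
    in the level.

    The completeness of [Q_p] is used through the uniqueness of the extension of its
    valuation ([valu_ext_unique]), which makes [v] invariant under Galois groups. *)

Set Implicit Arguments.
Unset Strict Implicit.
Unset Printing Implicit Defensive.

Import Order.TTheory GRing.Theory Num.Theory.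
Import numFieldNormedType.Exports.

Local Open Scope classical_set_scope.
Local Open Scope ring_scope.

(** * Non-archimedean valuations with values in the extended reals *)

Section ValuationTheory.
Variables (R : realType) (F : fieldType) (v : F -> \bar R).
Hypothesis v_val : valuation v.

Lemma valu0 : v 0 = +oo%E.
Proof. by case: v_val => h _ _ _; apply/h. Qed.

Lemma valu_fin x : x != 0 -> exists r : R, v x = r%:E.
Proof.
case: v_val => h1 h2 _ _ x0; move: (h2 x) (h1 x).
case: (v x) => [r||] //; first by exists r.
by move=> _ [h _]; case/eqP: x0; apply: h.
Qed.

Lemma valu_eqy x : v x = +oo%E -> x = 0.
Proof. by case: v_val => h _ _ _ /h. Qed.

Lemma valu_neq0 x (r : R) : v x = r%:E -> x != 0.
Proof. by move=> vx; apply/eqP => x0; move: vx; rewrite x0 valu0. Qed.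

Lemma valuM x y : v (x * y) = (v x + v y)%E.
Proof. by case: v_val. Qed.

Lemma valu1 : v 1 = 0%E.
Proof.
have [r vr] := valu_fin (oner_neq0 F).
have := valuM 1 1; rewrite mulr1 vr -EFinD => -[] h; congr (_%:E); lra.
Qed.

Lemma valuX x (r : R) n : v x = r%:E -> v (x ^+ n) = (n%:R * r)%:E.
Proof.
move=> vx; elim: n => [|n IHn]; first by rewrite expr0 valu1 mul0r.
by rewrite exprS valuM IHn vx -EFinD -natr1 mulrDl mul1r addrC.
Qed.

Lemma valuN1 : v (-1) = 0%E.
Proof.
have h : (-1 : F) != 0 by rewrite oppr_eq0 oner_neq0.
have [r vr] := valu_fin h.
have := valuM (-1) (-1); rewrite mulrNN mulr1 valu1 vr -EFinD => -[] ?.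
by congr (_%:E); lra.
Qed.

Lemma valuN x : v (- x) = v x.
Proof. by rewrite -mulN1r valuM valuN1 add0e. Qed.

Lemma valu_subC x y : v (x - y) = v (y - x).
Proof. by rewrite -valuN opprB. Qed.

Lemma valuV x (r : R) : v x = r%:E -> v x^-1 = (- r)%:E.
Proof.
move=> vx; have x0 := valu_neq0 vx.
have x0' : x^-1 != 0 by rewrite invr_eq0.
have [s vs] := valu_fin x0'.
have := valuM x x^-1; rewrite mulfV // valu1 vx vs -EFinD => -[] ?.
by congr (_%:E); lra.
Qed.

Lemma valuD (r : \bar R) x y : (r <= v x -> r <= v y -> r <= v (x + y))%E.
Proof.
move=> hx hy; case: v_val => _ _ _ /(_ x y); apply: le_trans.
by rewrite le_min hx.
Qed.

Lemma valuD_gt (r : \bar R) x y : (r < v x -> r < v y -> r < v (x + y))%E.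
Proof.
move=> hx hy; case: v_val => _ _ _ /(_ x y); apply: lt_le_trans.
by rewrite lt_min hx.
Qed.

Lemma valuB (r : \bar R) x y : (r <= v x -> r <= v y -> r <= v (x - y))%E.
Proof. by move=> hx hy; apply: valuD; rewrite ?valuN. Qed.

Lemma valuB_gt (r : \bar R) x y : (r < v x -> r < v y -> r < v (x - y))%E.
Proof. by move=> hx hy; apply: valuD_gt; rewrite ?valuN. Qed.

Lemma valuD_eq x y : (v x < v y)%E -> v (x + y) = v x.
Proof.
move=> h; apply/eqP; rewrite eq_le; apply/andP; split; last first.
  by apply: valuD => //; apply: ltW.
rewrite leNgt; apply/negP => h2.
by have := valuB_gt h2 h; rewrite addrK ltxx.
Qed.

Lemma valu_sum (I : Type) (s : seq I) (P : pred I) (G : I -> F) (r : \bar R) :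
  (forall i, P i -> r <= v (G i))%E -> (r <= v (\sum_(i <- s | P i) G i))%E.
Proof.
move=> h; elim/big_ind: _ => //; first by rewrite valu0 leey.
by move=> x y; apply: valuD.
Qed.

Lemma valu_sum_gt (I : Type) (s : seq I) (P : pred I) (G : I -> F) (r : R) :
  (forall i, P i -> r%:E < v (G i))%E -> (r%:E < v (\sum_(i <- s | P i) G i))%E.
Proof.
move=> h; elim/big_ind: _ => //; first by rewrite valu0 ltey.
by move=> x y; apply: valuD_gt.
Qed.

Lemma valuM_ge (r s : R) x y :
  (r%:E <= v x -> s%:E <= v y -> (r + s)%:E <= v (x * y))%E.
Proof. by move=> hx hy; rewrite valuM EFinD; apply: leeD. Qed.

Lemma valuM_ge0 x y : (0 <= v x -> 0 <= v y -> 0 <= v (x * y))%E.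
Proof. by move=> hx hy; rewrite valuM adde_ge0. Qed.

Lemma valuM_ger (r : \bar R) x y : (0 <= v x -> r <= v y -> r <= v (x * y))%E.
Proof. by move=> hx hy; rewrite valuM -[r]add0e; apply: leeD. Qed.

Lemma valuM_gel (r : \bar R) x y : (r <= v x -> 0 <= v y -> r <= v (x * y))%E.
Proof. by move=> hx hy; rewrite mulrC; apply: valuM_ger. Qed.

Lemma valuX_ge0 x n : (0 <= v x -> 0 <= v (x ^+ n))%E.
Proof.
move=> hx; elim: n => [|n IHn]; first by rewrite expr0 valu1.
by rewrite exprS valuM_ge0.
Qed.

Lemma valuX_ge (r : R) x n : (r%:E <= v x -> (n%:R * r)%:E <= v (x ^+ n))%E.
Proof.
move=> hx; elim: n => [|n IHn]; first by rewrite expr0 valu1 mul0r.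
by rewrite exprS -natr1 mulrDl mul1r addrC; apply: valuM_ge.
Qed.

Lemma valuX_gt0 x n : (0 < n)%N -> ((0 < v (x ^+ n)) = (0 < v x))%E.
Proof.
move=> n0; have [->|x0] := eqVneq x 0; first by rewrite expr0n eqn0Ngt n0.
have [r vr] := valu_fin x0; rewrite vr (valuX n vr) !lte_fin.
by rewrite pmulr_rgt0 // ltr0n.
Qed.

Lemma valu_nat n : (0 <= v n%:R)%E.
Proof.
elim: n => [|n IHn]; first by rewrite valu0 leey.
by rewrite -natr1; apply: valuD => //; rewrite valu1.
Qed.

Lemma valu_int (m : int) : (0 <= v m%:~R)%E.
Proof.
case: m => n; first exact: valu_nat.
by rewrite NegzE mulrNz valuN; apply: valu_nat.
Qed.

Lemma valu_prod (I : Type) (s : seq I) (P : pred I) (G : I -> F) :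
  v (\prod_(i <- s | P i) G i) = (\sum_(i <- s | P i) v (G i))%E.
Proof.
elim: s => [|i s IHs]; first by rewrite !big_nil valu1.
by rewrite !big_cons; case: (P i) => //; rewrite valuM IHs.
Qed.

End ValuationTheory.

(** * The valuation of the p-adic field *)

Section PadicField.
Variables (R : realType) (p : nat) (p_prime : prime p).
Variables (Qp : fieldType) (vp : Qp -> \bar R) (Qp_def : padic_completion p vp).

Let vp_val : valuation vp. Proof. by case: Qp_def. Qed.

Lemma padic_val_p : vp p%:R = 1%:E.
Proof.
case: Qp_def => _ /(_ p%:R) h _ _; rewrite ratr_nat in h.
rewrite h /padic_val pnatr_eq0 -[p == 0%N]negbK -lt0n prime_gt0 //=.
rewrite -[p%:R]/(p%:Z%:~R) numq_int denq_int /= logn1 subr0.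
by rewrite lognE p_prime prime_gt0 // dvdnn divnn prime_gt0 // logn1.
Qed.

(** A rational number close to [x] has the valuation of [x]. *)
Lemma padic_val_int (x : Qp) : x != 0 -> exists m : int, vp x = (m%:~R)%:E.
Proof.
move=> x0; have [r vr] := valu_fin vp_val x0.
case: Qp_def => _ hq /(_ x (r + 1)) [q xq] _.
have vq : vp (ratr q) = vp x.
  rewrite -[ratr q](subrK x) addrC; apply: (valuD_eq vp_val).
  by rewrite vr (valu_subC vp_val); apply: lt_le_trans xq; rewrite lte_fin ltrDl.
move: (hq q); rewrite vq vr /padic_val; case: eqP => // _ -[->].
exists ((logn p `|numq q|%N)%:Z - (logn p `|denq q|%N)%:Z).
by rewrite rmorphB.
Qed.

(** The residue field of the p-adic integers is the prime field: a p-integral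
    rational [r / s] has [s] prime to [p], and a Bezout relation
    [u * s + k * p = 1] makes it congruent to the integer [r * u]. *)
Lemma padic_int_approx_nat (x : Qp) : (0 <= vp x)%E ->
  exists n : nat, (0 < vp (x - n%:R))%E.
Proof.
move=> x_int; case: (Qp_def) => _ hq /(_ x 1) [q xq] _.
have gt01 : ((0 : R)%:E < 1%:E)%E by rewrite lte_fin.
have q_int : (0 <= vp (ratr q))%E.
  rewrite -[ratr q](subrK x) addrC; apply: (valuD vp_val) => //.
  by rewrite (valu_subC vp_val); apply: le_trans xq; rewrite lee_fin.
suff [m qm] : exists m : int, (0 < vp (ratr q - m%:~R))%E.
  have p0 : p%:Z != 0 by rewrite eqz_nat -lt0n prime_gt0.
  exists `|(m %% p%:Z)%Z|%N.
  have -> : x - `|(m %% p)%Z|%N%:R =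
      (x - ratr q) + (ratr q - m%:~R) + (m %/ p)%Z%:~R * p%:R.
    have : (m%:~R : Qp) = ((m %/ p)%Z * p + (m %% p)%Z)%:~R.
      by rewrite -divz_eq.
    rewrite rmorphD rmorphM /= -[(m %% p)%Z in X in _ = X]gez0_abs ?modz_ge0 //.
    by move=> ->; rewrite -!pmulrn; ring.
  apply: (valuD_gt vp_val); first apply: (valuD_gt vp_val) => //.
    exact: lt_le_trans xq.
  rewrite (valuM vp_val) padic_val_p.
  by apply: (lt_le_trans gt01); rewrite leeDr // (valu_int vp_val).
have [->|q0] := eqVneq q 0.
  by exists 0; rewrite (ratr_nat _ 0) subrr (valu0 vp_val) ltey.
have den_p : ~~ (p %| `|denq q|)%N.
  apply/negP => pd; have := hq q; rewrite /padic_val (negbTE q0) => vq.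
  move: q_int; rewrite vq lee_fin subr_ge0 ler_nat => le_log.
  have := pd; rewrite -[p]expn1 pfactor_dvdn // ?absz_gt0 ?denq_neq0 // => d1.
  have pn : (p %| `|numq q|)%N.
    rewrite -[p]expn1 pfactor_dvdn //; last by rewrite absz_gt0 numq_eq0.
    exact: leq_trans le_log.
  have := coprime_num_den q; rewrite /coprime => /eqP c1.
  have : (p %| 1)%N by rewrite -c1 dvdn_gcd pn pd.
  by rewrite dvdn1; case: (p) p_prime => [|[|]].
have co : coprimez (denq q) p%:Z.
  by rewrite /coprimez /gcdz /= eqz_nat -/(coprime _ _) coprime_sym prime_coprime.
have [[u w] uw] : exists u, u.1 * denq q + u.2 * p%:Z = 1.
  by have /coprimezP[u hu] := co; exists u.
rewrite /= in uw.
exists (numq q * u).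
have -> : ratr q - (numq q * u)%:~R = ratr q * w%:~R * p%:R :> Qp.
  have dq : ratr q * (denq q)%:~R = (numq q)%:~R :> Qp.
    have := hq (denq q)%:~R; rewrite ratr_int /padic_val intr_eq0 denq_eq0 => vd.
    rewrite /ratr mulfVK //; apply/eqP => d0.
    by move: vd; rewrite d0 (valu0 vp_val).
  rewrite rmorphM /= -dq -[X in X - _]mulr1 -[1 in X in X - _](rmorph1 intr) -uw.
  by rewrite rmorphD !rmorphM /= -pmulrn; ring.
rewrite (valuM vp_val) padic_val_p.
apply: (lt_le_trans gt01); rewrite leeDr // (valuM_ge0 vp_val) //.
exact: (valu_int vp_val).
Qed.

End PadicField.

(** * Elements algebraic over the p-adic field *)

(** The Frobenius congruence, in a form that keeps a factor [d] in the error
    term, so that raising to the power [p] also improves congruences. *)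
Lemma expp_add (R : realType) (F : fieldType) (v : F -> \bar R) (p : nat) (y d : F) :
    valuation v -> prime p -> (0 <= v y)%E -> (0 <= v d)%E ->
  exists2 q, (0 <= v q)%E & (y + d) ^+ p = y ^+ p + d ^+ p + p%:R * d * q.
Proof.
case: p => [|[|k]] // v_val p_prime y_int d_int.
exists (\sum_(i < k.+1) ('C(k.+2, i.+1) %/ k.+2)%:R * (y ^+ (k.+1 - i) * d ^+ i)).
  apply: (valu_sum v_val) => i _.
  by rewrite (valuM_ge0 v_val) ?(valu_nat v_val) ?(valuM_ge0 v_val) ?(valuX_ge0 v_val).
rewrite exprDn big_ord_recl /= bin0 subn0 mulr1n expr0 mulr1 -addrA; congr (_ + _).
rewrite big_ord_recr /= addrC /bump /= !add1n subnn expr0 mul1r binn mulr1n.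
congr (_ + _); rewrite mulr_sumr; apply: eq_bigr => i _.
rewrite add1n subSS.
have pC : (k.+2 %| 'C(k.+2, i.+1))%N by rewrite prime_dvd_bin //= ltnS.
by rewrite -[in LHS](divnK pC) -[in LHS]mulr_natr natrM exprS; ring.
Qed.

Section AlgebraicElements.
Variables (R : realType) (p : nat) (p_prime : prime p).
Variables (Qp : fieldType) (vp : Qp -> \bar R) (Qp_def : padic_completion p vp).
Variables (F : fieldType) (v : F -> \bar R) (v_val : valuation v).
Variables (j : {rmorphism Qp -> F}) (v_j : forall x, v (j x) = vp x).
Variables (x : F) (P : {poly Qp}).
Hypotheses (P_neq0 : P != 0) (Px : root (map_poly j P) x).

Let vp_val : valuation vp. Proof. by case: Qp_def. Qed.

Let sumP : \sum_(i < size P) j P`_i * x ^+ i = 0.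
Proof.
move: Px; rewrite /root horner_coef size_map_poly => /eqP e.
by rewrite -[RHS]e; apply: eq_bigr => i _; rewrite coef_map.
Qed.

(** Two terms of an algebraic relation of [x] share the minimal valuation, hence
    [(i - k) * v x] is an integer for two distinct exponents [i] and [k], and
    their difference divides [n!]. *)
Lemma valu_denominator n : (size P <= n.+1)%N -> x != 0 ->
  exists m : int, v x = (m%:~R / n`!%:R)%:E.
Proof.
move=> szP x0; have [r vr] := valu_fin v_val x0.
pose f (i : 'I_(size P)) : R := fine (v (j P`_i * x ^+ i)).
have sz0 : (0 < size P)%N by rewrite size_poly_gt0.
have lastP : ((size P).-1 < size P)%N by rewrite prednK.
have vt (i : 'I_(size P)) : P`_i != 0 -> exists2 m : int,
    v (j P`_i * x ^+ i) = (f i)%:E & f i = m%:~R + i%:R * r.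
  move=> Pi0; have [m vm] := padic_val_int Qp_def Pi0.
  have e : v (j P`_i * x ^+ i) = (m%:~R + i%:R * r)%:E.
    by rewrite (valuM v_val) v_j vm (valuX v_val _ vr).
  by exists m; rewrite /f e.
have P0 : P`_(Ordinal lastP) != 0 by rewrite /= -lead_coefE lead_coef_eq0.
have [i0 Pi0 min0] := arg_minP f (P := fun i : 'I_(size P) => P`_i != 0) P0.
have [i1 [i10 Pi1 fi1]] : exists i1, [/\ i1 != i0, P`_i1 != 0 & f i1 <= f i0].
  apply: contrapT => hn.
  have lt_others : (v (j P`_i0 * x ^+ i0)
      < v (\sum_(i < size P | i != i0) j P`_i * x ^+ i))%E.
    have [m -> _] := vt _ Pi0; apply: (valu_sum_gt v_val) => i ii0.
    have [-> |Pi] := eqVneq P`_i 0; first by rewrite rmorph0 mul0r (valu0 v_val) ltey.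
    have [m' -> _] := vt _ Pi; rewrite lte_fin ltNge; apply/negP => le_f.
    by apply: hn; exists i.
  have := valuD_eq v_val lt_others.
  have := sumP; rewrite (bigD1 i0) //= => ->; rewrite (valu0 v_val).
  by have [m -> _] := vt _ Pi0.
have {}fi1 : f i1 = f i0 by apply/le_anti; rewrite fi1 min0.
have [m0 _ e0] := vt _ Pi0; have [m1 _ e1] := vt _ Pi1.
have er : (i1%:Z - i0%:Z)%:~R * r = (m0 - m1)%:~R.
  rewrite !rmorphB /= -!pmulrn; move: fi1; rewrite e0 e1; lra.
have dn0 : i1%:Z - i0%:Z != 0 by rewrite subr_eq0 eqz_nat.
have : (`|i1%:Z - i0%:Z|%N %| n`!)%N.
  apply: dvdn_fact; rewrite absz_gt0 dn0 /=.
  have := ltn_ord i1; have := ltn_ord i0; by move: (i0 : nat) (i1 : nat) => a b; lia.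
rewrite -[n`!]/(`|n`!%:Z|%N) => /dvdzP [k ek].
exists (k * (m0 - m1)); rewrite vr rmorphM /= -er mulrA -rmorphM /= -ek -pmulrn.
by rewrite mulrC mulKf // pnatr_eq0 -lt0n fact_gt0.
Qed.

Let v_p : v p%:R = 1%:E.
Proof. by rewrite -(rmorph_nat j) v_j (padic_val_p p_prime Qp_def). Qed.

(** Divide the polynomial by a coefficient of least valuation, chosen of highest
    degree: modulo the maximal ideal the result is a monic polynomial over the
    prime field. *)
Lemma residue_relation : (0 <= v x)%E ->
  exists d, exists c : nat -> nat,
    (0 < v (x ^+ d - \sum_(i < d) (c i)%:R * x ^+ i))%E.
Proof.
move=> x_int.
have sz0 : (0 < size P)%N by rewrite size_poly_gt0.
have lastP : ((size P).-1 < size P)%N by rewrite prednK.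
pose f (i : 'I_(size P)) : R := fine (vp P`_i).
have vf (i : 'I_(size P)) : P`_i != 0 -> vp P`_i = (f i)%:E.
  by move=> /(valu_fin vp_val)[r e]; rewrite /f e.
have P0 : P`_(Ordinal lastP) != 0 by rewrite /= -lead_coefE lead_coef_eq0.
have [i0 Pi0 min0] := arg_minP f (P := fun i : 'I_(size P) => P`_i != 0) P0.
pose A (i : 'I_(size P)) := (P`_i != 0) && (f i == f i0).
have Ai0 : A i0 by rewrite /A Pi0 eqxx.
have [d /andP[Pd /eqP fd] max_d] := arg_maxnP (fun i : 'I_(size P) => i : nat) Ai0.
pose u i : Qp := P`_i / P`_d.
have vu (i : 'I_(size P)) : P`_i != 0 -> vp (u i) = (f i - f d)%:E.
  by move=> Pi; rewrite (valuM vp_val) (valuV vp_val (vf _ Pd)) (vf _ Pi).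
have u_int (i : 'I_(size P)) : (0 <= vp (u i))%E.
  have [e|Pi] := eqVneq P`_i 0; first by rewrite /u e mul0r (valu0 vp_val) leey.
  by rewrite vu // lee_fin subr_ge0 fd min0.
have u_gt (i : 'I_(size P)) : (d < i)%N -> (0 < vp (u i))%E.
  move=> di; have [e|Pi] := eqVneq P`_i 0.
    by rewrite /u e mul0r (valu0 vp_val) ltey.
  rewrite vu // lte_fin subr_gt0 fd lt_neqAle min0 // andbT eq_sym.
  apply/negP => fi; have := max_d i; rewrite /A Pi fi => /(_ isT) /=.
  by move: di; rewrite ltnNge => /negbTE ->.
have /choice[c hc] (i : nat) : exists n : nat,
    ((i < d)%N -> 0 < vp (- u i - n%:R))%E.
  have [id|] := ltnP i d; last by exists 0.
  have [|n hn] := padic_int_approx_nat p_prime Qp_def (x := - u i).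
    by rewrite (valuN vp_val) (u_int (Ordinal (ltn_trans id (ltn_ord d)))).
  by exists n.
exists d; exists c.
have := sumP; rewrite (eq_bigr (fun i : 'I_(size P) => j P`_d * (j (u i) * x ^+ i))); last first.
  by move=> i _; rewrite mulrA -rmorphM /u mulrCA mulfV // mulr1.
rewrite -mulr_sumr => /eqP; rewrite mulf_eq0 fmorph_eq0 (negbTE Pd) /= => /eqP sumu.
pose G i := j (u i) * x ^+ i.
have sumG : \sum_(i < d) G i + x ^+ d + \sum_(d.+1 <= i < size P) G i = 0.
  have ud : G d = x ^+ d by rewrite /G /u divff // rmorph1 mul1r.
  have := sumu; rewrite -(big_mkord xpredT G) (@big_cat_nat _ _ _ d.+1) //=.
  by rewrite (big_mkord xpredT G) big_ord_recr /= ud.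
have -> : x ^+ d - \sum_(i < d) (c i)%:R * x ^+ i =
  \sum_(i < d) (- G i - (c i)%:R * x ^+ i) - \sum_(d.+1 <= i < size P) G i.
  rewrite sumrB sumrN; apply/eqP; rewrite -subr_eq0 -[X in _ == X]sumG.
  by apply/eqP; ring.
apply: (valuB_gt v_val).
  apply: (valu_sum_gt v_val) => i _.
  have -> : - G i - (c i)%:R * x ^+ i = j (- u i - (c i)%:R) * x ^+ i.
    by rewrite rmorphB rmorphN rmorph_nat /G; ring.
  rewrite (valuM v_val) v_j; apply: (@lt_le_trans _ _ (vp (- u i - (c i)%:R))).
    exact: hc.
  by rewrite leeDl // (valuX_ge0 v_val).
rewrite big_nat_cond; apply: (valu_sum_gt v_val) => i; rewrite andbT => /andP[di iP].
rewrite (valuM v_val) v_j; apply: (@lt_le_trans _ _ (vp (u i))).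
  exact: (u_gt (Ordinal iP)).
by rewrite leeDl // (valuX_ge0 v_val).
Qed.

(** Modulo the maximal ideal the powers of [x] lie in the span, over the prime
    field, of the [d] first ones. *)
Lemma residue_power_finite : (0 <= v x)%E ->
  exists d, forall k, exists c : {ffun 'I_d -> 'I_p},
    (0 < v (x ^+ k - \sum_(i < d) (c i)%:R * x ^+ i))%E.
Proof.
move=> x_int; have [d [c0 hc0]] := residue_relation x_int; exists d => k.
pose red y := exists c : nat -> nat, (0 < v (y - \sum_(i < d) (c i)%:R * x ^+ i))%E.
have redD y z : red y -> red z -> red (y + z).
  move=> [c hc] [c' hc']; exists (fun i => c i + c' i)%N.
  rewrite (eq_bigr (fun i : 'I_d => (c i)%:R * x ^+ i + (c' i)%:R * x ^+ i)).
    by rewrite big_split /= opprD addrACA; apply: (valuD_gt v_val).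
  by move=> i _; rewrite natrD mulrDl.
have red0 : red 0.
  exists (fun=> 0); rewrite big1 ?subrr ?(valu0 v_val) ?ltey // => i _.
  by rewrite mul0r.
have redZ n y : red y -> red (n%:R * y).
  move=> hy; elim: n => [|n IHn]; first by rewrite mul0r.
  by rewrite -natr1 mulrDl mul1r; apply: redD.
have red_eq y z : red z -> (0 < v (y - z))%E -> red y.
  move=> [c hc] hyz; exists c.
  by rewrite -[y](subrK z) -addrA; apply: (valuD_gt v_val).
have redX i : (i <= d)%N -> red (x ^+ i).
  rewrite leq_eqVlt => /orP[/eqP->|id]; first by exists c0.
  exists (fun k => (k == i : nat)); rewrite (bigD1 (Ordinal id)) //= eqxx mul1r big1.
    by rewrite addr0 subrr (valu0 v_val) ltey.
  by move=> k0 k0i; rewrite -val_eqE /= in k0i; rewrite (negbTE k0i) mul0r.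
have [c hc] : red (x ^+ k).
  elim: k => [|k [c hc]]; first exact: redX.
  apply: (red_eq _ (\sum_(i < d) (c i)%:R * x ^+ i.+1)).
    by elim/big_ind: _ => // i _; apply/redZ/redX/ltn_ord.
  have -> : \sum_(i < d) (c i)%:R * x ^+ i.+1 = x * \sum_(i < d) (c i)%:R * x ^+ i.
    by rewrite mulr_sumr; apply: eq_bigr => i _; rewrite exprS mulrCA.
  rewrite exprS -mulrBr (valuM v_val); apply: (lt_le_trans hc).
  by rewrite leeDr.
have modp_lt i : (c i %% p < p)%N by rewrite ltn_mod prime_gt0.
exists [ffun i : 'I_d => Ordinal (modp_lt i)].
have -> : x ^+ k - \sum_(i < d) ([ffun i0 : 'I_d => Ordinal (modp_lt i0)] i)%:R * x ^+ i
  = (x ^+ k - \sum_(i < d) (c i)%:R * x ^+ i)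
    + \sum_(i < d) ((c i %/ p)%:R * x ^+ i) * p%:R.
  rewrite -addrA; congr (_ + _); rewrite -sumrN -sumrN -big_split /=.
  apply: eq_bigr => i _; rewrite ffunE /= [in X in - (X * _) + _](divn_eq (c i) p).
  by rewrite natrD natrM; ring.
apply: (valuD_gt v_val) => //; apply: (valu_sum_gt v_val) => i _.
rewrite (valuM v_val) v_p; apply: (@lt_le_trans _ _ 1%:E); first by rewrite lte_fin.
by rewrite leeDr // (valuM_ge0 v_val) ?(valu_nat v_val) ?(valuX_ge0 v_val).
Qed.

(** By the pigeonhole principle two of the powers [x ^ (p ^ k)] are congruent, and
    Frobenius is injective on residues: the residue of [x] lies in a finite field.
    So [x ^ (p ^ (m * k))] are lifts of the residue of [x] on which inertia acts
    more and more trivially, a substitute for Teichmueller representatives. *)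
Lemma residue_finite_order : (0 <= v x)%E ->
  exists2 m, (0 < m)%N & (0 < v (x ^+ (p ^ m) - x))%E.
Proof.
move=> x_int; have [d /choice[c hc]] := residue_power_finite x_int.
pose T := {ffun 'I_d -> 'I_p}.
pose f (i : 'I_(#|{: T}|).+1) : T := c (p ^ i)%N.
have /injectivePn[i [k ik fik]] : ~~ injectiveb f.
  by apply/negP => /injectiveP/leq_card; rewrite card_ord ltnn.
wlog lt_ik : i k ik fik / (i < k)%N.
  move=> hw; have := ik; rewrite -val_eqE neq_ltn /= => /orP[|] h.
    exact: (hw i k).
  by apply: (hw k i) => //; rewrite eq_sym.
have [e ek] : exists e, (k : nat) = (e + i)%N.
  by exists (k - i)%N; rewrite subnK // ltnW.
exists e; first by move: lt_ik; rewrite ek; lia.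
have : (0 < v (x ^+ (p ^ k) - x ^+ (p ^ i)))%E.
  have -> : x ^+ (p ^ k) - x ^+ (p ^ i) =
      (x ^+ (p ^ k) - \sum_(l < d) (f k l)%:R * x ^+ l) -
      (x ^+ (p ^ i) - \sum_(l < d) (f i l)%:R * x ^+ l) by rewrite fik; ring.
  by apply: (valuB_gt v_val); apply: hc.
rewrite ek expnD exprM; move: (x ^+ (p ^ e)) (valuX_ge0 v_val (p ^ e) x_int).
move=> y y_int.
elim: {ek ik fik lt_ik} (i : nat) => [|n IHn]; first by rewrite expn0 !expr1.
rewrite expnSr !exprM => h; apply: IHn.
pose a := x ^+ (p ^ n); pose b := y ^+ (p ^ n).
have a_int : (0 <= v a)%E by apply: valuX_ge0.
have b_int : (0 <= v b)%E by apply: valuX_ge0.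
have [q q_int hq] := expp_add v_val p_prime a_int (valuB v_val b_int a_int).
rewrite -/a -/b in h *; rewrite -(valuX_gt0 v_val _ (prime_gt0 p_prime)).
have -> : (b - a) ^+ p = (b ^+ p - a ^+ p) - p%:R * (b - a) * q.
  have -> : b ^+ p = a ^+ p + (b - a) ^+ p + p%:R * (b - a) * q.
    by rewrite -hq addrC subrK.
  by ring.
apply: (valuB_gt v_val) => //; rewrite -mulrA (valuM v_val) v_p.
apply: (@lt_le_trans _ _ 1%:E); first by rewrite lte_fin.
by rewrite leeDl // (valuM_ge0 v_val) // (valuB v_val).
Qed.

End AlgebraicElements.

(** * Uniqueness of the extension of the p-adic valuation *)

Lemma valuXz (R : realType) (F : fieldType) (v : F -> \bar R) x (r : R) (m : int) :
  valuation v -> v x = r%:E -> v (x ^ m)%R = (m%:~R * r)%:E.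
Proof.
move=> v_val vx; case: m => n; first exact: (valuX v_val).
rewrite NegzE -exprnN (valuV v_val (valuX v_val _ vx)).
by rewrite mulrNz mulNr.
Qed.

Lemma fieldExt_annihilator (F : fieldType) (L : fieldExtType F) (x : L) :
  exists P : {poly F}, [/\ P != 0, root (map_poly (in_alg L) P) x
    & (size P <= (\dim {:L}).+1)%N].
Proof.
have /polyOver1P[P hP] := minPolyOver 1 x; exists P; split.
- have := monic_neq0 (monic_minPoly 1 x); rewrite hP.
  by apply: contraNneq => ->; rewrite map_poly0.
- by rewrite -hP root_minPoly.
- rewrite -(size_map_poly (in_alg L)) -hP size_minPoly ltnS.
  by rewrite adjoin_degreeE dimv1 divn1 dimvS // subvf.
Qed.

Section NormEquivalence.
Variables (R : realType) (p : nat) (p_prime : prime p).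
Variables (Qp : fieldType) (vp : Qp -> \bar R) (Qp_def : padic_completion p vp).
Variables (L : fieldExtType Qp).

Let vp_val : valuation vp. Proof. by case: Qp_def. Qed.

(** The equivalence of norms, by induction on the dimension.  Given the bound on
    the span of the first [n] vectors, either the last vector [e n] stays away
    from that span, and its coordinate is controlled, or it is a limit of elements
    of the span; then their coordinates are Cauchy and converge because the base
    field is complete, so [e n] lies in the span. *)
Lemma coord_bound (v : L -> \bar R) (v_val : valuation v)
    (v_vp : forall c : Qp, v c%:A = vp c) (e : nat -> L) n :
  (forall c : nat -> Qp, \sum_(i < n) c i *: e i = 0 ->
     forall i, (i < n)%N -> c i = 0) ->
  exists C : R, forall (c : nat -> Qp) (M : R),
    (M%:E <= v (\sum_(i < n) c i *: e i)%R)%E ->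
    forall i, (i < n)%N -> ((M - C)%:E <= vp (c i))%E.
Proof.
have vZ c x : v (c *: x)%R = (vp c + v x)%E.
  by rewrite -mulr_algl (valuM v_val) v_vp.
elim: n => [|n IHn] indep; first by exists 0.
have e_neq0 i : (i < n.+1)%N -> e i != 0.
  move=> ilt; apply/eqP => ei0.
  have sum0 : \sum_(k < n.+1) ((k : nat) == i)%:R *: e k = 0.
    apply: big1 => k _.
    by have [->|_] := eqVneq (k : nat) i; rewrite ?ei0 ?scaler0 ?scale0r.
  have := indep (fun k => (k == i)%:R) sum0 i ilt.
  by rewrite eqxx => /eqP; rewrite oner_eq0.
have [|C hC] := IHn.
  move=> c hc i ilt; pose c' k := if k == n then 0 else c k.
  have -> : c i = c' i by rewrite /c' ltn_eqF.
  apply: indep; last exact: ltnW.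
  rewrite big_ord_recr /= {2}/c' eqxx scale0r addr0 -[RHS]hc.
  by apply: eq_bigr => k _; rewrite /c' ltn_eqF.
have [r0 vr0] := valu_fin v_val (e_neq0 n (ltnSn n)).
have [[C0 hC0]|hC0] := pselect (exists C0 : R, forall c : nat -> Qp,
    (v (e n + \sum_(i < n) c i *: e i)%R < C0%:E)%E).
  exists (`|C0| + `|C0 - r0| + `|C|) => c M; rewrite big_ord_recr /= => hM.
  have hn : ((M - C0)%:E <= vp (c n))%E.
    have [->|cn0] := eqVneq (c n) 0; first by rewrite (valu0 vp_val) leey.
    have [t vt] := valu_fin vp_val cn0.
    have := hC0 (fun i => c i / c n) => hlt.
    have vE : v (\sum_(i < n) c i *: e i + c n *: e n)%R =
        (vp (c n) + v (e n + \sum_(i < n) (c i / c n) *: e i)%R)%E.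
      rewrite -vZ scalerDr addrC scaler_sumr; congr (v (_ + _)%R).
      by apply: eq_bigr => i _; rewrite scalerA mulrC divfK.
    rewrite vt lee_fin; move: hM; rewrite vE vt.
    move: (v _) hlt => [s||]; rewrite ?lte_fin ?lee_fin //= => *; lra.
  have hM' : ((M - `|C0 - r0|)%:E <= v (\sum_(i < n) c i *: e i)%R)%E.
    rewrite -[\sum_(i < n) _](addrK (c n *: e n)); apply: (valuB v_val).
      by apply: le_trans hM; rewrite lee_fin gerBl.
    rewrite vZ vr0; apply: (le_trans _ (leeD hn (lexx _))).
    by rewrite -EFinD lee_fin; have := ler_norm (C0 - r0); lra.
  move=> i; rewrite ltnS leq_eqVlt => /orP[/eqP->|ilt].
    apply: le_trans hn; rewrite lee_fin.
    by have := ler_norm C0; have := normr_ge0 (C0 - r0); have := normr_ge0 C; lra.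
  apply: le_trans (hC _ _ hM' i ilt); rewrite lee_fin.
  by have := ler_norm C; have := normr_ge0 C0; lra.
have /choice[c hc] (N : nat) : exists c : nat -> Qp,
    (N%:R%:E <= v (e n + \sum_(i < n) c i *: e i)%R)%E.
  apply: contrapT => hn; apply: hC0; exists N%:R => c.
  by rewrite ltNge; apply/negP => h; apply: hn; exists c.
have arch (M : R) : exists N : nat, M <= N%:R.
  by exists (Num.bound `|M|); exact/ltW/(le_lt_trans (ler_norm M))/archi_boundP.
have c_cauchy i : (i < n)%N -> val_cauchy vp (fun N => c N i).
  move=> ilt M; have [N hN] := arch (M + C); exists N => k l Nk Nl.
  have h : ((N%:R - C)%:E <= vp (c k i - c l i)%R)%E.
    apply: (hC (fun i => c k i - c l i) N%:R _ i ilt).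
    have -> : \sum_(i0 < n) (c k i0 - c l i0) *: e i0 =
      (e n + \sum_(i0 < n) c k i0 *: e i0) - (e n + \sum_(i0 < n) c l i0 *: e i0).
      rewrite opprD addrACA subrr add0r -sumrB.
      by apply: eq_bigr => i0 _; rewrite scalerBl.
    by apply: (valuB v_val); [apply: le_trans (hc k)|apply: le_trans (hc l)];
       rewrite lee_fin ler_nat.
  by apply: le_trans h; rewrite lee_fin; lra.
have /choice[l hl] (i : nat) : exists l : Qp,
    (i < n)%N -> val_cvg vp (fun N => c N i) l.
  have [ilt|_] := ltnP i n; last by exists 0.
  by case: Qp_def => _ _ _ /(_ _ (c_cauchy i ilt)) [l hl]; exists l.
suff e0 : e n + \sum_(i < n) l i *: e i = 0.
  have := indep (fun k => if k == n then 1 else l k) _ n (ltnSn n).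
  rewrite eqxx big_ord_recr /= eqxx scale1r addrC => h.
  have /eqP : (1 : Qp) = 0.
    apply: h; rewrite -[RHS]e0; congr (_ + _); apply: eq_bigr => i _.
    by rewrite ltn_eqF.
  by rewrite oner_eq0.
apply: (valu_eqy v_val); apply/eqyP => M _.
have /choice[Ni hNi] (i : nat) : exists N, forall k, (i < n)%N -> (N <= k)%N ->
    (M%:E <= v ((c k i - l i) *: e i)%R)%E.
  have [ilt|_] := ltnP i n; last by exists 0.
  have [s vs] := valu_fin v_val (e_neq0 i (ltnW ilt)).
  have [N hN] := hl i ilt (M - s); exists N => k _ /hN h.
  rewrite vZ vs; apply: le_trans (leeD h (lexx _)).
  by rewrite -EFinD subrK.
have [N0 hN0] := arch M.
pose N := (N0 + \sum_(i < n) Ni i)%N.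
have -> : e n + \sum_(i < n) l i *: e i =
  (e n + \sum_(i < n) c N i *: e i) - \sum_(i < n) (c N i - l i) *: e i.
  rewrite -addrA -sumrB; congr (_ + _); apply: eq_bigr => i _.
  by rewrite -scalerBl opprB addrC subrK.
apply: (valuB v_val).
  by apply: le_trans (hc N); rewrite lee_fin (le_trans hN0) // ler_nat leq_addr.
apply: (valu_sum v_val) => i _; apply: hNi => //.
by rewrite /N (bigD1 i) //= addnCA leq_addr.
Qed.

(** If [v x > 0] the powers of [x] tend to [0] for [v], so do their coordinates in a
    fixed basis, and hence the powers tend to [0] for [v'] as well. *)
Lemma valu_ext_pos (v v' : L -> \bar R) :
    valuation v -> valuation v' ->
    (forall c : Qp, v c%:A = vp c) -> (forall c : Qp, v' c%:A = vp c) ->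
  forall x, (0 < v x -> 0 < v' x)%E.
Proof.
move=> v_val v'_val v_vp v'_vp x vx_gt0.
have [->|x0] := eqVneq x 0; first by rewrite (valu0 v'_val) ltey.
pose b := vbasis {:L}; pose n := \dim {:L}.
have b_basis : basis_of {:L} b := vbasisP _.
have [|C hC] := @coord_bound v v_val v_vp (fun i => b`_i) n.
  move=> c hc i ilt; have /freeP := basis_free b_basis.
  move=> /(_ (fun i => c i)) /(_ hc) /(_ (Ordinal ilt)) //.
have [r vr] := valu_fin v_val x0.
have r_gt0 : 0 < r by move: vx_gt0; rewrite vr lte_fin.
have [D hD] : exists D : R, forall i : 'I_n, ((- D)%:E <= v' b`_i)%E.
  have b_neq0 (i : 'I_n) : b`_i != 0.
    by apply: (free_not0 (basis_free b_basis)); rewrite mem_nth // size_tuple.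
  have /choice[s hs] (i : 'I_n) : exists s : R, v' b`_i = s%:E.
    exact: valu_fin.
  exists (\sum_i `|s i|) => i; rewrite hs lee_fin (bigD1 i) //=.
  rewrite opprD; apply: (@le_trans _ _ (- `|s i|)); last first.
    by rewrite lerNl ler_normr lexx orbT.
  by rewrite gerDl oppr_le0 sumr_ge0.
have [k hk] : exists k : nat, C + D < k%:R * r.
  have := archi_boundP (normr_ge0 ((C + D) / r)).
  set k := Num.bound _ => hk; exists k; rewrite -ltr_pdivrMr //.
  by apply: le_lt_trans (ler_norm _) hk.
have k_gt0 : (0 < k.+1)%N by [].
rewrite -(valuX_gt0 v'_val _ k_gt0).
have xk := coord_vbasis (memvf (x ^+ k.+1)).
have hvx : ((k.+1%:R * r)%:E <= v (\sum_(i < n) coord b i (x ^+ k.+1) *: b`_i)%R)%E.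
  by rewrite -xk (valuX v_val _ vr).
pose cc (i : nat) : Qp := oapp (fun i : 'I_n => coord b i (x ^+ k.+1)) 0 (insub i).
have ccE (i : 'I_n) : cc i = coord b i (x ^+ k.+1) by rewrite /cc valK.
rewrite xk; apply: (@lt_le_trans _ _ (k.+1%:R * r - C - D)%:E).
  by rewrite lte_fin -natr1; lra.
apply: (valu_sum v'_val) => i _.
rewrite -mulr_algl (valuM v'_val) v'_vp EFinD; apply: leeD; last exact: hD.
rewrite -ccE; apply: hC => //.
by move: hvx; rewrite (eq_bigr (fun i : 'I_n => cc i *: b`_i)) // => *; rewrite ccE.
Qed.

(** Since [N * v x] is an integer [m], the element [x ^ N / p ^ m] has valuation
    [0] for [v], hence also for [v'] by the previous lemma applied in both
    directions. *)
Lemma valu_ext_unique (v v' : L -> \bar R) :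
    valuation v -> valuation v' ->
    (forall c : Qp, v c%:A = vp c) -> (forall c : Qp, v' c%:A = vp c) ->
  v =1 v'.
Proof.
move=> v_val v'_val v_vp v'_vp x.
have [->|x0] := eqVneq x 0; first by rewrite (valu0 v_val) (valu0 v'_val).
have [P [P0 Px szP]] := fieldExt_annihilator x.
have [m vm] := valu_denominator p_prime Qp_def v_val (j := in_alg L) v_vp P0 Px szP x0.
have [r' vr'] := valu_fin v'_val x0.
set N := (\dim _)`! in vm.
have N0 : N%:R != 0 :> R by rewrite pnatr_eq0 -lt0n fact_gt0.
have v_p : v p%:R = 1%:E.
  by rewrite -(rmorph_nat (in_alg L)) v_vp (padic_val_p p_prime Qp_def).
have v'_p : v' p%:R = 1%:E.
  by rewrite -(rmorph_nat (in_alg L)) v'_vp (padic_val_p p_prime Qp_def).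
pose y := x ^+ N * (p%:R ^ (- m)).
have vy : v y = 0%E.
  rewrite (valuM v_val) (valuX v_val _ vm) (valuXz _ v_val v_p) -EFinD.
  by congr (_%:E); rewrite mulrNz mulr1 mulrC divfK // subrr.
have v'y : v' y = (N%:R * r' - m%:~R)%:E.
  rewrite (valuM v'_val) (valuX v'_val _ vr') (valuXz _ v'_val v'_p) -EFinD.
  by rewrite mulrNz mulr1.
have e : N%:R * r' - m%:~R = 0.
  apply/eqP; rewrite eq_le -!lee_fin -v'y; apply/andP; split.
    rewrite leNgt; apply/negP => /(valu_ext_pos v'_val v_val v'_vp v_vp).
    by rewrite vy ltxx.
  rewrite leNgt; apply/negP => h.
  have h' : (0 < v' (y^-1)%R)%E.
    by rewrite (valuV v'_val v'y) lte_fin oppr_gt0 -lte_fin -v'y.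
  have := valu_ext_pos v'_val v_val v'_vp v_vp h'.
  by rewrite (valuV v_val vy) oppr0 ltxx.
rewrite vm vr'; congr (_%:E); apply: (mulfI N0).
by rewrite mulrC divfK //; lra.
Qed.

End NormEquivalence.

(** * Polynomials with approximate roots, and ramification groups *)

(** If [P] were to vanish at the points [x] of [xs] it would be divisible by
    their product of linear factors, so that [v P.[z]] would be at least the sum of
    the [v (z - x)].  When the values [P.[x]] are merely small the same bound
    holds up to a precision that depends only on [xs]; dividing by one linear
    factor loses at most the distance [D] between the points. *)
Lemma near_roots (R : realType) (F : fieldType) (v : F -> \bar R) (xs : seq F) :
    valuation v -> uniq xs -> (forall x, x \in xs -> 0 <= v x)%E ->
  exists2 C : R, 0 <= C & forall (P : {poly F}) (z : F) (N r : R),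
    (forall i, 0 <= v P`_i)%E -> (0 <= v z)%E ->
    (forall x, x \in xs -> N%:E <= v P.[x])%E ->
    r <= N - C -> (r%:E <= \sum_(x <- xs) v (z - x)%R)%E -> (r%:E <= v P.[z])%E.
Proof.
move=> v_val; elim: xs => [_ _|x1 xs IH /= /andP[x1xs uxs] xs_int].
  exists 0 => // P z N r P_int z_int _ _; rewrite big_nil => r0.
  apply: le_trans r0 _; rewrite horner_coef; apply: (valu_sum v_val) => i _.
  by rewrite (valuM_ge0 v_val) // (valuX_ge0 v_val).
have [|C C0 hC] := IH uxs; first by move=> x xxs; rewrite xs_int // inE xxs orbT.
have x1_int : (0 <= v x1)%E by rewrite xs_int // mem_head.
have fin_diff x : x \in xs -> exists r : R, v (x - x1)%R = r%:E.
  move=> xxs; apply: (valu_fin v_val); rewrite subr_eq0.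
  by apply: contraNneq x1xs => <-.
have [D D0 hD] : exists2 D : R, 0 <= D &
    forall x, x \in xs -> (v (x - x1)%R <= D%:E)%E.
  elim: xs fin_diff {IH x1xs uxs xs_int hC} => [_|y ys IHys fd]; first by exists 0.
  have [D D0 hD] := IHys (fun x xx => fd x (mem_behead (s := y :: ys) xx)).
  have [r hr] := fd y (mem_head _ _).
  exists (D + `|r|); first by rewrite addr_ge0.
  move=> x; rewrite inE => /orP[/eqP->|xys].
    by rewrite hr lee_fin (le_trans (ler_norm r)) // lerDr.
  by apply: le_trans (hD x xys) _; rewrite lee_fin lerDl.
exists (C + D); first by rewrite addr_ge0.
move=> P z N r P_int z_int hN rN; rewrite big_cons => hr.
have rN' : r <= N by lra.
have [ex|zx1] := eqVneq z x1.
  by apply: le_trans (hN z _); rewrite ?lee_fin // ex mem_head.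
have [t vt] : exists t : R, v (z - x1)%R = t%:E.
  by apply: (valu_fin v_val); rewrite subr_eq0.
have t0 : 0 <= t by rewrite -lee_fin -vt; apply: (valuB v_val).
have [Q hQ] : exists Q, P - P.[x1]%:P = Q * ('X - x1%:P).
  by apply/factor_theorem; rewrite /root !hornerE subrr.
have PE y : P.[y] = Q.[y] * (y - x1) + P.[x1].
  by rewrite -[P in LHS](subrK P.[x1]%:P) hQ !hornerE.
have Q_int i : (0 <= v Q`_i)%E.
  (* Horner division determines the coefficients from the top down. *)
  have step k : Q`_k = P`_k.+1 + x1 * Q`_k.+1.
    have := congr1 (fun q : {poly F} => q`_k.+1) hQ.
    rewrite coefB coefC /= subr0 mulrBr coefB coefMX /= coefMC => ->.
    by ring.
  have [n hn] := ubnP (size Q - i)%N.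
  elim: n => // n IHn in i hn *.
  have [szi|szi] := leqP (size Q) i; first by rewrite nth_default // (valu0 v_val) leey.
  rewrite step; apply: (valuD v_val) => //; apply: (valuM_ge0 v_val) => //.
  by apply: IHn; rewrite subnSK // -ltnS.
rewrite PE; apply: (valuD v_val); last first.
  by apply: le_trans (hN x1 (mem_head _ _)); rewrite lee_fin.
rewrite mulrC -[r](subrK t) addrC; apply: (valuM_ge v_val); first by rewrite vt.
apply: (hC Q z (N - D)) => //.
- move=> x xxs; have [d vd] := fin_diff x xxs.
  have dD : d <= D by rewrite -lee_fin -vd hD.
  have : ((N%:E : \bar R) <= v (Q.[x] * (x - x1))%R)%E.
    have -> : Q.[x] * (x - x1) = P.[x] - P.[x1] by rewrite [P.[x]]PE addrK.
    by apply: (valuB v_val); apply: hN; rewrite !inE ?eqxx ?xxs ?orbT.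
  rewrite (valuM v_val) vd; case: (v Q.[x]) => [q||] //=; rewrite ?lee_fin ?leey //.
  by move=> ?; lra.
- by lra.
move: hr; rewrite vt; case: (\sum_(x <- xs) _)%E => [q||] //=; rewrite ?lee_fin ?leey //.
by move=> ?; lra.
Qed.

(** Each power of [p] improves a congruence by one unit: with [d = y - z],
    [y ^ p - z ^ p] is [d ^ p] plus a multiple of [p * d]. *)
Lemma valuB_expp (R : realType) (F : fieldType) (v : F -> \bar R) (p : nat) (y z : F) k :
    valuation v -> prime p -> (1%:E <= v p%:R)%E -> (0 <= v z)%E ->
    (1%:E <= v (y - z)%R)%E ->
  (k.+1%:R%:E <= v (y ^+ (p ^ k) - z ^+ (p ^ k))%R)%E.
Proof.
move=> v_val p_prime vp z_int yz.
elim: k => [|k IHk]; first by rewrite expn0 !expr1.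
rewrite expnSr !exprM; move: (y ^+ _) (z ^+ _) (valuX_ge0 v_val (p ^ k) z_int) IHk.
move=> {y z z_int yz} y z z_int yz.
have k0 : (0 <= k.+1%:R%:E :> \bar R)%E by rewrite lee_fin.
have d_int := le_trans k0 yz.
have [q q_int hq] := expp_add v_val p_prime z_int d_int.
rewrite addrC subrK in hq; rewrite hq.
have -> a b c : a + b + c - a = b + c :> F by ring.
apply: (valuD v_val).
  apply: le_trans (valuX_ge v_val p yz); rewrite lee_fin -natrM ler_nat.
  by have := prime_gt1 p_prime; nia.
apply: (valuM_gel v_val) => //; rewrite -natr1 addrC.
exact: (valuM_ge v_val).
Qed.

Section Inertia.
Variables (R : realType) (F : fieldType) (L : splittingFieldType F).
Variables (w : L -> \bar R) (w_norm : normalized_valuation w).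

Let w_val : valuation w. Proof. by case: w_norm. Qed.

Lemma lower_ramifP u (s : gal_of {:L}) :
  reflect (forall x, (0 <= w x)%E -> ((u + 1)%:E <= w (s x - x)%R)%E)
          (s \in lower_ramif w u).
Proof.
rewrite /lower_ramif inE.
have -> : s \in 'Gal({:L} / 1)%g.
  by rewrite gal_kHom ?sub1v // k1HomE; apply: ahomWin.
exact: asboolP.
Qed.

Lemma lower_ramifS u t : u <= t -> lower_ramif w t \subset lower_ramif w u.
Proof.
move=> ut; apply/fintype.subsetP => s /lower_ramifP hs; apply/lower_ramifP => x /hs.
by apply: le_trans; rewrite lee_fin lerD2r.
Qed.

Lemma group_set_lower_ramif u : 0 <= u -> group_set (lower_ramif w u).
Proof.
move=> u0; apply/group_setP; split.
  by apply/lower_ramifP => x _; rewrite gal_id subrr (valu0 w_val) leey.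
move=> s t /lower_ramifP hs /lower_ramifP ht; apply/lower_ramifP => x x_int.
rewrite galM ?memvf //.
have sx_int : (0 <= w (s x))%E.
  rewrite -[s x](subrK x); apply: (valuD w_val) => //.
  by apply: le_trans (hs x x_int); rewrite lee_fin; lra.
rewrite -[t (s x)](subrK (s x)) -addrA.
by apply: (valuD w_val); [apply: ht | apply: hs].
Qed.

Canonical lower_ramif_group u (u0 : 0 <= u) := Group (group_set_lower_ramif u0).

Lemma normalized_int x : x != 0 -> exists m : int, w x = (m%:~R)%:E.
Proof.
case: w_norm => _ h x0; have : (w @` [set x | x != 0]) (w x) by exists x.
by rewrite h => -[m _ <-]; exists m.
Qed.

Lemma normalized_ge1 x : (0 < w x)%E -> (1%:E <= w x)%E.
Proof.
have [->|x0] := eqVneq x 0; first by rewrite (valu0 w_val) leey.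
have [m ->] := normalized_int x0; rewrite lte_fin lee_fin ltr0z -[1]/(1%:~R).
by rewrite ler_int; lia.
Qed.

Lemma uniformizer_exists : exists pi, w pi = 1%:E.
Proof.
case: w_norm => _ h; have : range (fun k : int => (k%:~R : R)%:E) 1%:E by exists 1.
by rewrite -h => -[x _ <-]; exists x.
Qed.

End Inertia.

(** * Inertia acting on a uniformizer *)

Section InertiaApprox.
Variables (R : realType) (F : fieldType) (L : splittingFieldType F).
Variables (w : L -> \bar R) (w_norm : normalized_valuation w).
Variables (p : nat) (p_prime : prime p) (w_p : (1%:E <= w p%:R)%E).
Hypothesis w_res : forall x, (0 <= w x)%E ->
  exists2 m, (0 < m)%N & (0 < w (x ^+ (p ^ m) - x)%R)%E.
Variables (pi : L) (w_pi : w pi = 1%:E).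

Let w_val : valuation w. Proof. by case: w_norm. Qed.
Let G0 := lower_ramif w 0.

Let pi0 : pi != 0. Proof. exact: valu_neq0 w_pi. Qed.

Lemma inertiaB s x : s \in G0 -> (0 <= w x)%E -> (1%:E <= w (s x - x)%R)%E.
Proof. by move=> /lower_ramifP h /h; rewrite add0r. Qed.

Lemma inertia_int s x : s \in G0 -> (0 <= w x)%E -> (0 <= w (s x))%E.
Proof.
move=> sG x_int; rewrite -[s x](subrK x); apply: (valuD w_val) => //.
by apply: le_trans (inertiaB sG x_int); rewrite lee_fin.
Qed.

(** Write [x = y * pi ^ n]: inertia keeps [y] integral, and [s pi] is divisible by
    [pi] because it is congruent to [pi]. *)
Lemma inertia_ge s x (n : nat) : s \in G0 ->
  (n%:R%:E <= w x -> n%:R%:E <= w (s x))%E.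
Proof.
move=> sG hx.
have hy : (0 <= w (x / pi ^+ n)%R)%E.
  have [->|x0] := eqVneq x 0; first by rewrite mul0r (valu0 w_val) leey.
  have [r vr] := valu_fin w_val x0; move: hx.
  rewrite (valuM w_val) (valuV w_val (valuX w_val _ w_pi)) vr mulr1.
  by rewrite -EFinD !lee_fin subr_ge0.
have -> : s x = s (x / pi ^+ n) * s pi ^+ n.
  by rewrite -rmorphXn -rmorphM divfK // expf_neq0.
apply: (valuM_ger w_val); first exact: inertia_int.
rewrite -[n%:R]mulr1; apply: (valuX_ge w_val).
have pi_int : (0 <= w pi)%E by rewrite w_pi lee_fin.
rewrite -[s pi](subrK pi); apply: (valuD w_val); last by rewrite w_pi.
exact: inertiaB.
Qed.

(** Take a power [r ^ (p ^ (m * N))], congruent to [r].  As [s r] is congruent to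
    [r], raising to the power [p ^ (m * N)] improves that congruence to order
    [N]. *)
Lemma near_fixed_lift (N : nat) r : (0 <= w r)%E ->
  exists b, [/\ (0 <= w b)%E, (1%:E <= w (b - r)%R)%E &
    forall s, s \in G0 -> (N%:R%:E <= w (s b - b)%R)%E].
Proof.
move=> r_int; have [m m0 hm] := w_res r_int.
exists (r ^+ (p ^ (m * N))); split; first exact: (valuX_ge0 w_val).
  apply: (normalized_ge1 w_norm).
  elim: N => [|N IHN]; first by rewrite muln0 expn0 expr1 subrr (valu0 w_val) ltey.
  rewrite mulnS addnC expnD exprM -[_ ^+ _ - r](subrK (r ^+ (p ^ m) - r)).
  apply: (valuD_gt w_val) => //.
  have -> a b c : a - b - (c - b) = a - c :> L by ring.
  rewrite subrXX (valuM w_val); apply: (lt_le_trans IHN).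
  rewrite leeDl //; apply: (valu_sum w_val) => i _.
  by rewrite (valuM_ge0 w_val) // !(valuX_ge0 w_val).
move=> s sG; rewrite rmorphXn /=.
apply: le_trans (valuB_expp (m * N) w_val p_prime w_p r_int (inertiaB sG r_int)).
by rewrite lee_fin ler_nat; nia.
Qed.

(** The expansion of [y] in powers of the uniformizer, with digits that inertia
    fixes to order [N].  It replaces the monogenicity of the ring of integers over
    that of the inertia field. *)
Lemma inertia_approx (N M : nat) y : (0 <= w y)%E ->
  exists h : {poly L}, [/\ forall i, (0 <= w h`_i)%E,
    forall i s, s \in G0 -> (N%:R%:E <= w (s h`_i - h`_i)%R)%E &
    (M%:R%:E <= w (y - h.[pi])%R)%E].
Proof.
move=> y_int; elim: M => [|M [h [h_int h_fix hy]]].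
  exists 0; split=> [i|i s _|].
  - by rewrite coef0 (valu0 w_val) leey.
  - by rewrite coef0 raddf0 subrr (valu0 w_val) leey.
  - by rewrite horner0 subr0.
set r := (y - h.[pi]) / pi ^+ M.
have yE : y - h.[pi] = r * pi ^+ M by rewrite divfK // expf_neq0.
have r_int : (0 <= w r)%E.
  move: hy; rewrite yE (valuM w_val) (valuX w_val _ w_pi) mulr1.
  case: (w r) => [q||] //=; rewrite ?leey // !lee_fin.
  by rewrite lerDr.
have [b [b_int br b_fix]] := near_fixed_lift N r_int.
exists (h + b *: 'X^M); split=> [i|i s sG|].
- rewrite coefD coefZ coefXn; apply: (valuD w_val) => //.
  by apply: (valuM_ge0 w_val) => //; apply: (valu_nat w_val).
- rewrite coefD coefZ coefXn rmorphD rmorphM rmorph_nat opprD addrACA.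
  apply: (valuD w_val); first exact: h_fix.
  rewrite -mulrBl; apply: (valuM_gel w_val); first exact: b_fix.
  exact: (valu_nat w_val).
rewrite !hornerE opprD addrA yE -mulrBl -[M.+1]addn1 natrD addrC.
apply: (valuM_ge w_val); first by rewrite (valu_subC w_val).
by rewrite (valuX w_val _ w_pi) mulr1.
Qed.

Lemma gal_horner_near (N : nat) (h : {poly L}) (s : gal_of {:L}) x :
    (0 <= w x)%E -> (forall i, N%:R%:E <= w (s h`_i - h`_i)%R)%E -> (0 <= w (s x))%E ->
  (N%:R%:E <= w (s h.[x] - h.[s x])%R)%E.
Proof.
move=> x_int h_fix sx_int; rewrite !horner_coef rmorph_sum -sumrB.
apply: (valu_sum w_val) => i _; rewrite rmorphM rmorphXn /= -mulrBl.
by apply: (valuM_gel w_val) => //; apply: (valuX_ge0 w_val).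
Qed.

Lemma uniformizer_faithful s : s \in G0 -> s pi = pi -> s = 1%g.
Proof.
move=> sG s_pi; have pi_int : (0 <= w pi)%E by rewrite w_pi lee_fin.
have fix_int y : (0 <= w y)%E -> s y = y.
  move=> y_int; apply/eqP; rewrite -subr_eq0; apply/eqP.
  apply: (valu_eqy w_val); apply/eqyP => M _.
  pose N := Num.bound `|M|.
  have MN : (M%:E <= N%:R%:E :> \bar R)%E.
    by rewrite lee_fin; exact/ltW/(le_lt_trans (ler_norm M))/archi_boundP.
  apply: (le_trans MN); have [h [h_int h_fix hy]] := inertia_approx N N y_int.
  have -> : s y - y = s (y - h.[pi]) - (y - h.[pi]) + (s h.[pi] - h.[s pi]).
    by rewrite raddfB s_pi /=; ring.
  apply: (valuD w_val); first by apply: (valuB w_val) => //; apply: inertia_ge.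
  by apply: gal_horner_near => // [i|]; [exact: h_fix | rewrite s_pi].
apply/eqP/gal_eqP => x _; rewrite gal_id.
have [->|x0] := eqVneq x 0; first by rewrite raddf0.
have [m wm] := normalized_int w_norm x0.
have h : (0 <= w (x * pi ^+ `|m|)%R)%E.
  rewrite (valuM w_val) wm (valuX w_val _ w_pi) mulr1 -EFinD lee_fin.
  by rewrite natr_absz -intrD ler0z; lia.
have := fix_int _ h; rewrite rmorphM rmorphXn /= s_pi => /mulIf; apply.
by rewrite expf_neq0.
Qed.

(** The inequality on which the whole argument rests.  Write [y = h.[pi]] with
    coefficients fixed by inertia, up to a high precision.  For every [s] with
    [s y = y'] the point [s pi] is then nearly a root of [h - y'], so the product of
    the [pi - s pi] nearly divides the value [y - y'] of that polynomial at
    [pi]. *)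
Lemma inertia_sum_le y y' : (0 <= w y)%E -> (0 <= w y')%E -> y != y' ->
  (\sum_(s in G0 | s y == y') w (s pi - pi)%R <= w (y' - y)%R)%E.
Proof.
move=> y_int y'_int yy'; have pi_int : (0 <= w pi)%E by rewrite w_pi lee_fin.
pose T := [set s in G0 | s y == y']%SET.
have sT s : s \in T -> s \in G0 /\ s y = y' by rewrite inE => /andP[? /eqP].
have [r hr] : exists r : R, (\sum_(s in T) w (s pi - pi)%R)%E = r%:E.
  apply: (big_ind (fun t => exists r : R, t = r%:E)); first by exists 0.
    by move=> _ _ [a ->] [b ->]; exists (a + b).
  move=> s /sT[sG sy]; apply: (valu_fin w_val); rewrite subr_eq0.
  apply: contraNneq yy' => /(uniformizer_faithful sG) s1.
  by rewrite -sy s1 gal_id.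
rewrite (eq_bigl (fun s => s \in T)) => [|s]; last by rewrite [RHS]inE.
rewrite hr; pose xs := map (fun s : gal_of {:L} => s pi) (enum T).
have uxs : uniq xs.
  rewrite map_inj_in_uniq ?enum_uniq // => s t.
  rewrite !mem_enum => /sT[sG _] /sT[tG _] st.
  pose G := lower_ramif_group w_norm (lexx 0).
  have stG : (s * t^-1)%g \in G by rewrite groupM ?groupV.
  have := uniformizer_faithful stG; rewrite galM ?memvf // st -galM ?memvf //.
  by rewrite mulgV gal_id => /(_ erefl)/eqP; rewrite -eq_mulgV1 => /eqP.
have xs_int x : x \in xs -> (0 <= w x)%E.
  by case/mapP => s; rewrite mem_enum => /sT[sG _] ->; apply: inertia_int.
have [C C0 hC] := near_roots w_val uxs xs_int.
pose N := Num.bound `|r + C|.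
have rCN : r + C <= N%:R.
  exact/ltW/(le_lt_trans (ler_norm _))/archi_boundP.
have [h [h_int h_fix hy]] := inertia_approx N N y_int.
have PE x : (h - y'%:P).[x] = h.[x] - y' by rewrite !hornerE.
have : (r%:E <= w (h - y'%:P).[pi])%E.
  apply: (hC _ _ N%:R) => //; last 2 first.
  - by rewrite lerBrDr.
  - rewrite big_map big_enum /= -hr le_eqVlt; apply/orP; left; apply/eqP.
    by apply: eq_bigr => s _; rewrite (valu_subC w_val).
  - move=> i; rewrite coefB coefC; apply: (valuB w_val) => //.
    by case: eqP => // _; rewrite (valu0 w_val) leey.
  move=> x /mapP[s]; rewrite mem_enum => /sT[sG sy] ->; rewrite PE.
  have -> : h.[s pi] - y' = - (s h.[pi] - h.[s pi]) - s (y - h.[pi]).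
    by rewrite [s (y - _)]raddfB /= sy; ring.
  apply: (valuB w_val); last exact: inertia_ge.
  rewrite (valuN w_val); apply: gal_horner_near => // [i|]; first exact: h_fix.
  exact: inertia_int.
rewrite PE => hP; have -> : y' - y = (h.[pi] - y) - (h.[pi] - y') by ring.
apply: (valuB w_val) => //; rewrite (valu_subC w_val).
by apply: le_trans hy; rewrite lee_fin; apply: le_trans rCN; rewrite lerDl.
Qed.

End InertiaApprox.

(** * The order of the inertia group *)

Section InertiaIndex.
Variables (R : realType) (F : fieldType) (L : splittingFieldType F).
Variables (w : L -> \bar R) (w_norm : normalized_valuation w).
Variables (p : nat) (p_prime : prime p) (w_p : (1%:E <= w p%:R)%E).
Hypothesis w_res : forall x, (0 <= w x)%E ->
  exists2 m, (0 < m)%N & (0 < w (x ^+ (p ^ m) - x)%R)%E.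
Hypothesis w_gal : forall (s : gal_of {:L}) x, w (s x) = w x.

Let w_val : valuation w. Proof. by case: w_norm. Qed.
Let G0 := lower_ramif_group w_norm (lexx 0).

(** Dedekind independence of the automorphisms of the residue field induced by
    distinct cosets of the inertia group, stated with lifts.  The usual
    induction: subtracting [q1.1 x] times the relation from the relation at [x * b]
    removes the first term. *)
Lemma residual_independence (s : seq (gal_of {:L} * L)) :
    pairwise (fun q q' => (q.1 * q'.1^-1)%g \notin G0) s ->
    (forall q, q \in s -> 0 <= w q.2)%E ->
    (forall b, 0 <= w b -> 0 < w (\sum_(q <- s) q.2 * q.1 b)%R)%E ->
  forall q, q \in s -> (0 < w q.2)%E.
Proof.
have [n] := ubnP (size s); elim: n s => // n IHn [//|q1 s] /=; rewrite ltnS => szs.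
move=> /andP[/allP /= q1s pws] s_int sum_gt0.
have tail_gt0 q : q \in s -> (0 < w q.2)%E.
  move=> qs.
  have [x [x_int hx]] : exists x, (0 <= w x)%E /\ ~ (0 < w (q.1 x - q1.1 x)%R)%E.
    apply: contrapT => hn; case/negP: (q1s q qs); apply/lower_ramifP => x x_int.
    rewrite add0r; apply: (normalized_ge1 w_norm).
    rewrite galM ?memvf // -(w_gal q.1) raddfB /= -galM ?memvf // mulVg gal_id.
    rewrite (valu_subC w_val).
    by apply: contrapT => h; apply: hn; exists x.
  (* The relation at [x * b] minus [q1.1 x] times the relation at [b]. *)
  pose s' := map (fun t : gal_of {:L} * L => (t.1, t.2 * (t.1 x - q1.1 x))) s.
  have diff_int (t : gal_of {:L}) : (0 <= w (t x - q1.1 x)%R)%E.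
    by apply: (valuB w_val); rewrite w_gal.
  have : (0 < w (q.2 * (q.1 x - q1.1 x))%R)%E.
    apply: (IHn s' _ _ _ _ (q.1, q.2 * (q.1 x - q1.1 x))); rewrite ?size_map //.
    - by rewrite pairwise_map.
    - move=> _ /mapP[t ts ->] /=; apply: (valuM_ge0 w_val) => //.
      by apply: s_int; rewrite inE ts orbT.
    - move=> b b_int; rewrite big_map /=.
      have -> : \sum_(t <- s) t.2 * (t.1 x - q1.1 x) * t.1 b =
          \sum_(t <- q1 :: s) t.2 * t.1 (x * b)
          - q1.1 x * \sum_(t <- q1 :: s) t.2 * t.1 b.
        rewrite mulr_sumr -sumrB big_cons rmorphM /=.
        have -> : q1.2 * (q1.1 x * q1.1 b) - q1.1 x * (q1.2 * q1.1 b) = 0 by ring.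
        by rewrite add0r; apply: eq_bigr => t _; rewrite rmorphM /=; ring.
      apply: (valuB_gt w_val); first by apply/sum_gt0/(valuM_ge0 w_val).
      rewrite (valuM w_val); apply: (lt_le_trans (sum_gt0 b b_int)).
      by rewrite leeDr // w_gal.
    - by apply/mapP; exists q.
  have -> : w (q.2 * (q.1 x - q1.1 x))%R = w q.2.
    rewrite (valuM w_val); have : w (q.1 x - q1.1 x)%R = 0%E.
      by apply/eqP; rewrite eq_le diff_int andbT leNgt; apply/negP.
    by move=> ->; rewrite adde0.
  by [].
move=> q; rewrite inE => /orP[/eqP->|]; last exact: tail_gt0.
have := sum_gt0 1; rewrite (valu1 w_val) => /(_ (lexx _)).
rewrite big_cons rmorph1 mulr1 => h.
rewrite -[q1.2](addrK (\sum_(t <- s) t.2 * t.1 1)).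
apply: (valuB_gt w_val) => //; rewrite big_seq_cond.
apply: (valu_sum_gt w_val) => t; rewrite andbT => ts.
by rewrite rmorph1 mulr1 tail_gt0.
Qed.

Variables (pi : L) (w_pi : w pi = 1%:E).
Hypothesis L_gal : galois 1 {:L}.
Hypothesis L_char : forall n, (0 < n)%N -> n%:R != 0 :> L.

(** The ramification index over the base field is at most the order of the inertia
    group.  The norm [y] of [pi] for the inertia group has value [#|G0|] and is
    fixed by inertia.  By residual independence there is [b] such that the sum
    over the cosets of [g b * g y] has the value of [y]; for a lift [b'] of [b]
    nearly fixed by inertia, the trace of [b' * y] is [#|G0|] times that sum to a
    high precision. *)
Lemma card_inertia_value : exists z : F, w z%:A = (#|G0|%:R)%:E.
Proof.
pose G := 'Gal({:L} / 1)%G.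
have G0G : G0 \subset G.
  by apply/fintype.subsetP => s; rewrite inE => /andP[].
pose y := \prod_(s in G0) s pi.
have wy : w y = (#|G0|%:R)%:E.
  rewrite (valu_prod w_val) (eq_bigr (fun=> 1%:E)) => [|s _]; last by rewrite w_gal.
  by rewrite sumEFin sumr_const.
have y0 : y != 0 by apply: valu_neq0 wy.
have y_fix s : s \in G0 -> s y = y.
  move=> sG; rewrite /y rmorph_prod /= (reindex_inj (mulIg s^-1)%g) /=.
  apply: eq_big => [t|t tG]; first by rewrite groupMr ?groupV.
  by rewrite -galM ?memvf // -mulgA mulVg mulg1.
pose RC := rcosets G0 G.
have RCP A : A \in RC -> A = (G0 :* repr A)%g.
  by move=> /rcosetsP[x _ ->]; rewrite rcoset_repr.
pose u (g : gal_of {:L}) := g y / y.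
have wu g : w (u g) = 0%E.
  by rewrite (valuM w_val) (valuV w_val wy) w_gal wy -EFinD subrr.
pose s := map (fun A : {set gal_of {:L}} => (repr A, u (repr A))) (enum RC).
have [b [b_int hb]] : exists b, (0 <= w b)%E /\ ~ (0 < w (\sum_(q <- s) q.2 * q.1 b)%R)%E.
  apply: contrapT => hn.
  have G0RC : (G0 : {set _}) \in RC by apply/rcosetsP; exists 1%g; rewrite ?group1 ?mulg1 ?rcoset1.
  suff : (0 < w (u (repr G0)))%E by rewrite wu ltxx.
  apply: (residual_independence (s := s) _ _ _ (q := (repr (G0 : {set _}), u (repr (G0 : {set _}))))).
  - rewrite pairwise_map; apply: (@sub_in_pairwise _ (mem RC) (fun A B => A != B)).
    + move=> A B ARC BRC /=; apply: contra => h.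
      apply/eqP; rewrite (RCP A ARC) (RCP B BRC); apply: rcoset_eqP.
      by rewrite mem_rcoset.
    + by apply/allP => A; rewrite mem_enum.
    + by rewrite -uniq_pairwise enum_uniq.
  - by move=> q /mapP[A _ ->] /=; rewrite wu.
  - by move=> b b_int; apply: contrapT => h; apply: hn; exists b.
  - by apply/mapP; exists (G0 : {set _}); rewrite ?mem_enum.
have sum_int x : (0 <= w x)%E -> (0 <= w (\sum_(q <- s) q.2 * q.1 x)%R)%E.
  move=> x_int; rewrite big_map; apply: (valu_sum w_val) => A _ /=.
  by apply: (valuM_ge0 w_val); rewrite ?wu ?w_gal.
have cG0 : (0 < #|G0|)%N := cardG_gt0 G0.
have [c wc] := valu_fin w_val (L_char cG0).
pose N := Num.bound `|c + #|G0|%:R|.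
have Nbig : c + #|G0|%:R < N%:R.
  exact/(le_lt_trans (ler_norm _))/archi_boundP.
have [b' [b'_int bb' b'_fix]] := near_fixed_lift w_norm p_prime w_p w_res w_pi N b_int.
have wS : w (\sum_(q <- s) q.2 * q.1 b')%R = 0%E.
  apply/eqP; rewrite eq_le sum_int // andbT leNgt; apply/negP => h; apply: hb.
  have -> : \sum_(q <- s) q.2 * q.1 b =
     \sum_(q <- s) q.2 * q.1 b' - \sum_(q <- s) q.2 * q.1 (b' - b).
    by rewrite -sumrB; apply: eq_bigr => q _; rewrite raddfB /=; ring.
  apply: (valuB_gt w_val) => //; rewrite big_map.
  apply: (valu_sum_gt w_val) => A _ /=; rewrite (valuM w_val) wu add0e w_gal.
  by apply: lt_le_trans bb'; rewrite lte_fin.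
have trE : galTrace 1 {:L} (b' * y) =
    #|G0|%:R * y * (\sum_(q <- s) q.2 * q.1 b')
    + \sum_(A in RC) \sum_(t in G0) repr A ((t b' - b') * y).
  rewrite /galTrace (set_partition_big _ (rcosets_partition G0G)) /=.
  rewrite big_map big_enum /= mulr_sumr -big_split /=; apply: eq_bigr => A ARC.
  rewrite {1}(RCP A ARC) (reindex_inj (mulIg (repr A))) /=.
  have -> : #|G0|%:R * y * (u (repr A) * repr A b') =
      \sum_(t in G0) repr A (b' * y).
    by rewrite sumr_const rmorphM /= /u -mulr_natl; field.
  rewrite -big_split /=; apply: eq_big => [t|t].
    by rewrite mem_rcoset mulgK.
  rewrite mem_rcoset mulgK => tG.
  rewrite galM ?memvf // -raddfD /=; congr (repr A _ : L).
  by rewrite rmorphM /= y_fix //; ring.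
have wTr : w (galTrace 1 {:L} (b' * y))%R = (c + #|G0|%:R)%:E.
  have e : w (#|G0|%:R * y * (\sum_(q <- s) q.2 * q.1 b'))%R = (c + #|G0|%:R)%:E.
    by rewrite !(valuM w_val) wS wc wy adde0 EFinD.
  rewrite trE (valuD_eq w_val) e //; apply: (@lt_le_trans _ _ N%:R%:E).
    by rewrite lte_fin.
  apply: (valu_sum w_val) => A _; apply: (valu_sum w_val) => t tG; rewrite w_gal.
  apply: (valuM_gel w_val); first exact: b'_fix.
  by rewrite wy lee_fin.
have /vlineP[a ha] : galTrace 1 {:L} (b' * y) \in 1%VS.
  by apply: mem_galTrace => //; apply: memvf.
exists (a / #|G0|%:R).
have -> : (a / #|G0|%:R)%:A = a%:A / #|G0|%:R :> L.
  by rewrite -[LHS]/(in_alg L _) rmorphM fmorphV rmorph_nat.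
rewrite -ha (valuM w_val) wTr (valuV w_val wc) -EFinD; congr (_%:E).
by rewrite addrAC subrr add0r.
Qed.

End InertiaIndex.

(** * The Herbrand function *)

Section Herbrand.
Variables (R : realType) (F : fieldType) (L : splittingFieldType F).
Variables (w : L -> \bar R) (w_norm : normalized_valuation w).

Notation mu := (@lebesgue_measure R).
Let G (u : R) := lower_ramif w u.
(* [Num.max 0 t] makes [h] nonincreasing on the whole line; [G t] is a group only
   for nonnegative [t]. *)
Let h (t : R) : R := #|G (Num.max 0 t)|%:R.

Let h_ni : nonincreasing_fun h.
Proof.
move=> s t st; rewrite /h ler_nat; apply/subset_leq_card/lower_ramifS.
by rewrite ge_max !le_max lexx /= st orbT.
Qed.

Let h_pos t : 0 <= t -> 1 <= h t.
Proof.
move=> t0; rewrite /h max_r // ler1n.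
exact: (cardG_gt0 (lower_ramif_group w_norm t0)).
Qed.

Let N0_gt0 : 0 < #|G 0|%:R :> R.
Proof. by rewrite ltr0n; apply: (cardG_gt0 (lower_ramif_group w_norm (lexx 0))). Qed.

Let h_integrable b : mu.-integrable `[0, b] (EFin \o h).
Proof.
apply: measurable_bounded_integrable => //=.
- by rewrite lebesgue_measure_itv /=; case: ifP; rewrite -?EFinB ?ltry.
- exact: nonincreasing_measurable.
- exists #|G 0|%:R; split; first exact: num_real.
  move=> M hM t _ /=; rewrite ger0_norm // (le_trans _ (ltW hM)) // ler_nat.
  by apply/subset_leq_card/lower_ramifS; rewrite le_max lexx.
Qed.

Let herbrandE u : herbrand w u = #|G 0|%:R^-1 * \int[mu]_(t in `[0, u]) h t.
Proof.
rewrite -RintegralZl //.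
apply: eq_Rintegral => t; rewrite inE /= in_itv /= => /andP[t0 _].
have sub : lower_ramif w t \subset lower_ramif w 0 by apply: lower_ramifS.
have := Lagrange (G := lower_ramif_group w_norm (lexx 0))
  (H := lower_ramif_group w_norm t0) sub => /= cG.
rewrite /h max_r // /G -cG natrM invfM mulrAC mulVf ?mul1r //.
by have := h_pos t0; rewrite /h max_r // => h1; apply: lt0r_neq0; apply: lt_le_trans h1.
Qed.

(** The Herbrand function is continuous, vanishes at [0] and has slope at least
    [1 / #|G 0|]. *)
Lemma herbrand_surj (y : R) : 0 <= y -> exists2 u, 0 <= u & herbrand w u = y.
Proof.
move=> y0; pose b := y * #|G 0|%:R; have b0 : 0 <= b by rewrite mulr_ge0 // ltW.
have cont := parameterized_integral_continuous b0 (h_integrable b).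
have int0 : parameterized_integral mu 0 0 h = 0.
  by rewrite /parameterized_integral set_itv1 Rintegral_set1.
have intb : b <= parameterized_integral mu 0 b h.
  have e : b = \int[mu]_(t in `[0, b]) (cst 1 t).
    rewrite Rintegral_cst //= lebesgue_measure_itv /= mul1r.
    move: b0; rewrite le_eqVlt => /orP[/eqP<-|b_gt0]; first by rewrite ltxx.
    by rewrite lte_fin b_gt0 /= subr0.
  rewrite {1}e /parameterized_integral; apply: le_Rintegral => //.
    apply: measurable_bounded_integrable => //=.
      by rewrite lebesgue_measure_itv /=; case: ifP; rewrite -?EFinB ?ltry.
    exists 1; split; first exact: num_real.
    by move=> M hM t _ /=; rewrite normr1 ltW.
  by move=> t /=; rewrite in_itv /= => /andP[t0 _]; apply: h_pos.
have [|u] := @IVT _ _ 0 b b b0 cont.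
  by rewrite int0 ge_min b0 /= le_max intb orbT.
rewrite in_itv /= => /andP[u0 _] hu; exists u => //.
rewrite herbrandE; move: hu; rewrite /parameterized_integral => ->.
by rewrite /b mulrC mulfK // lt0r_neq0.
Qed.

(** The integral of [#|G t|] over [[0, u]] counts, for each [s], the length of the
    set of the [t] for which [s] lies in [G t]; it is at most [u] for the identity
    and at most [i s] for the others. *)
Lemma herbrand_le (u : R) (i : gal_of {:L} -> R) : 0 <= u ->
    (forall s, s \in G 0 -> 0 <= i s) ->
    (forall s t, 0 <= t -> s \in G t -> s != 1%g -> t <= i s) ->
  herbrand w u * #|G 0|%:R <= u + \sum_(s in G 0 | s != 1%g) i s.
Proof.
move=> u0 i0 hi; rewrite herbrandE mulrAC mulVf ?lt0r_neq0 // mul1r.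
have G1 : 1%g \in G 0 by apply: (group1 (lower_ramif_group w_norm (lexx 0))).
pose i' s := if s == 1%g then u else i s.
have -> : u + \sum_(s in G 0 | s != 1%g) i s = \sum_(s in G 0) i' s.
  rewrite [RHS](bigD1 1%g) //= /i' eqxx; congr (_ + _).
  by apply: eq_bigr => s /andP[_ /negbTE ->].
have i'0 s : s \in G 0 -> 0 <= i' s by rewrite /i'; case: eqP => // _; apply: i0.
rewrite -lee_fin /Rintegral fineK; last first.
  by apply: integrable_fin_num => //; apply: h_integrable.
apply: (@le_trans _ _ (\int[mu]_(t in `[0%R, u])
    (\sum_(s <- enum (G 0)) (\1_(`[0%R, i' s]) t)%:E))%E).
  apply: ge0_le_integral => //=.
  - by move=> t _; rewrite lee_fin.
  - apply/measurable_EFinP; exact: nonincreasing_measurable.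
  - apply: emeasurable_sum => s.
    apply/measurable_EFinP; exact: measurable_indic.
  move=> t; rewrite in_itv /= => /andP[t0 tu].
  rewrite big_enum /= sumEFin lee_fin /h max_r //.
  rewrite -sum1_card natr_sum big_mkcond /= [leRHS]big_mkcond /=.
  apply: ler_sum => s _; case: ifP => [sGt|_]; last first.
    by case: ifP.
  have -> : s \in G 0 by apply: (fintype.subsetP (lower_ramifS w t0)).
  rewrite indicE mem_set //= in_itv /= t0 /= /i'.
  by case: eqP => // /eqP s1; apply: hi sGt _.
rewrite ge0_integral_sum //=; last first.
  by move=> s; apply/measurable_EFinP; exact: measurable_indic.
rewrite big_enum /= -sumEFin; apply: lee_sum => s sG; rewrite integral_indic //=.
apply: (@le_trans _ _ (mu `[0%R, i' s])).
  by apply: le_measure; rewrite ?inE //=; apply: measurableI.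
rewrite lebesgue_measure_itv /=; case: ifP => _; last by rewrite lee_fin i'0.
by rewrite -EFinB subr0.
Qed.

End Herbrand.

(** * The preimage tree in the algebraic closure *)

Definition unicritical (F : fieldType) (p : nat) (c z : F) : F := z ^+ p - c.

Section Tree.
Variables (R : realType) (p : nat) (p_prime : prime p).
Variables (F : closedFieldType) (v : F -> \bar R) (v_val : valuation v).
Hypothesis v_p : v p%:R = 1%:E.
Variables (a c : F).

Local Notation P := (p%:R : R).
(* [q] is [1 / (p - 1)], so that [1 + q] is [p / (p - 1)]. *)
Variables (q : R) (q_gt0 : 0 < q) (Pq : P * q = 1 + q).
Hypothesis v_c : v c = (- (1 + q))%:E.

Local Notation f := (unicritical p c).
(* The points [z] at which the derivative [p * z ^ (p - 1)] of [f] is a unit. *)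
Let good z := v z = (- q)%:E.

Local Lemma P_ge2 : 2 <= P. Proof. by rewrite (ler_nat _ 2) prime_gt1. Qed.
Lemma good_child z : ((- (1 + q))%:E < v (f z))%E -> good z.
Proof.
move=> h; have zp : v (z ^+ p)%R = (- (1 + q))%:E.
  by rewrite -[z ^+ p](subrK c) -/(unicritical p c z) addrC (valuD_eq v_val) v_c.
have z0 : z != 0.
  apply: contraTneq (valu_neq0 v_val zp) => ->.
  by rewrite expr0n eqn0Ngt prime_gt0 // eqxx.
have [r vr] := valu_fin v_val z0; move: zp; rewrite /good vr (valuX v_val _ vr) => -[e].
congr (_%:E); apply: (@mulfI _ P); first by apply: lt0r_neq0; have := P_ge2; lra.
by rewrite mulrN Pq.
Qed.

Lemma good_gt z : good z -> ((- (1 + q))%:E < v z)%E.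
Proof. by move=> ->; rewrite lte_fin; lra. Qed.

Local Lemma v_binom i : (0 < i < p)%N -> (1%:E <= v 'C(p, i)%:R)%E.
Proof.
move=> ip; have /dvdnP[m ->] := prime_dvd_bin p_prime ip.
by rewrite natrM (valuM v_val) v_p leeDr // (valu_nat v_val).
Qed.

Local Lemma expand (z d : F) : (z + d) ^+ p - z ^+ p =
  \sum_(1 <= i < p) (z ^+ (p - i) * d ^+ i) *+ 'C(p, i) + d ^+ p.
Proof.
rewrite exprDn -(big_mkord xpredT (fun i => (z ^+ (p - i) * d ^+ i) *+ 'C(p, i))).
rewrite big_nat_recr //= big_ltn ?prime_gt0 //.
by rewrite subnn subn0 bin0 binn !mulr1n expr0 mul1r mulr1; ring.
Qed.

Local Lemma term_ge z d (s : R) i : good z -> v d = s%:E -> (0 < i < p)%N ->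
  ((((i%:R - 1) * q + i%:R * s)%:E : \bar R) <= v ((z ^+ (p - i) * d ^+ i) *+ 'C(p, i))%R)%E.
Proof.
move=> gz vd ip; rewrite -[_ *+ 'C(p, i)]mulr_natl.
have e : (i%:R - 1) * q + i%:R * s = 1 + ((p - i)%:R * (- q) + i%:R * s).
  by rewrite natrB 1?ltnW ?(andP ip).2 //; move: Pq; lra.
rewrite e; apply: (valuM_ge v_val); first exact: v_binom.
by rewrite (valuM v_val) (valuX v_val _ gz) (valuX v_val _ vd).
Qed.

(** At a good point the coefficients of [(z + d) ^ p - z ^ p], as a polynomial in
    [d], are integral: the one of [d ^ i] has value at least [(i - 1) * q].  So
    the term [d ^ p] dominates when [v d < 0]. *)
Lemma pow_diff_neg z d (s : R) : good z -> v d = s%:E -> s < 0 ->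
  v ((z + d) ^+ p - z ^+ p)%R = (P * s)%:E.
Proof.
move=> gz vd s0; have vdp := valuX v_val p vd.
rewrite expand addrC (valuD_eq v_val) vdp //.
rewrite big_nat; apply: (valu_sum_gt v_val) => i ip.
apply: lt_le_trans (term_ge gz vd ip); rewrite lte_fin.
have i1 : 1 <= i%:R :> R by rewrite ler1n; case/andP: ip.
have iP : i%:R < p%:R :> R by rewrite ltr_nat; case/andP: ip.
have h1 : 0 <= (i%:R - 1) * q by rewrite mulr_ge0 ?subr_ge0 // ltW.
have h2 : 0 < (i%:R - p%:R) * s by rewrite nmulr_rgt0 // subr_lt0.
by lra.
Qed.

(** The coefficient of [d] has value [1 - (p - 1) * q = 0], so the linear term
    dominates when [v d > 0]. *)
Lemma pow_diff_pos z d (s : R) : good z -> v d = s%:E -> 0 < s ->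
  v ((z + d) ^+ p - z ^+ p)%R = s%:E.
Proof.
move=> gz vd s0; have p1 := prime_gt1 p_prime.
rewrite expand big_ltn //= bin1.
have v1 : v ((z ^+ (p - 1) * d ^+ 1) *+ p)%R = s%:E.
  rewrite -mulr_natl !(valuM v_val) v_p (valuX v_val _ gz) (valuX v_val 1 vd) -!EFinD.
  by congr (_%:E); rewrite natrB 1?ltnW // mul1r; move: Pq; lra.
rewrite -addrA (valuD_eq v_val) v1 //; apply: (valuD_gt v_val); last first.
  rewrite (valuX v_val _ vd) lte_fin ltr_pMl //.
  by rewrite (ltr_nat _ 1).
rewrite big_nat; apply: (valu_sum_gt v_val) => i /andP[i2 ip].
have ip' : (0 < i < p)%N by rewrite ip andbT ltnW.
apply: lt_le_trans (term_ge gz vd ip'); rewrite lte_fin.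
have i2' : 2 <= i%:R :> R by rewrite (ler_nat _ 2).
have h1 : 0 < (i%:R - 1) * q by rewrite mulr_gt0 //; lra.
have h2 : 0 <= (i%:R - 2) * s by rewrite mulr_ge0 ?subr_ge0 // ltW.
by lra.
Qed.

(** This is where the value [- p / (p - 1)] of [c] matters: over a good point the
    map is separable modulo the maximal ideal, so distinct preimages of one point
    stay distinct residually. *)
Lemma siblings_dist z z' : good z -> f z' = f z -> z' != z -> v (z' - z)%R = 0%E.
Proof.
move=> gz fz zz'; have e : z' ^+ p - z ^+ p = 0.
  by apply/eqP; rewrite subr_eq0; apply/eqP/(addIr (- c)).
have d0 : z' - z != 0 by rewrite subr_eq0.
have [s vs] := valu_fin v_val d0; rewrite vs; congr (_%:E).
have [s0|s0|//] := ltgtP s 0.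
  have := pow_diff_neg gz vs s0; rewrite (addrC z) subrK e (valu0 v_val) //.
by have := pow_diff_pos gz vs s0; rewrite (addrC z) subrK e (valu0 v_val).
Qed.

(** Passing to preimages divides negative distances by [p] and keeps integral
    ones. *)
Lemma child_dist (t : R) z z' : 0 <= t -> good z ->
  ((- (P * t))%:E <= v (f z' - f z)%R -> (- t)%:E <= v (z' - z)%R)%E.
Proof.
move=> t0 gz; have -> : f z' - f z = z' ^+ p - z ^+ p by rewrite /unicritical; ring.
have [->|] := eqVneq z' z; first by rewrite !subrr (valu0 v_val) !leey.
rewrite -subr_eq0 => d0 h; have [s vs] := valu_fin v_val d0; rewrite vs lee_fin.
have [s0|s0] := ltP s 0; last by lra.
have := pow_diff_neg gz vs s0; rewrite (addrC z) subrK => e.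
by move: h; rewrite e lee_fin -mulrN ler_pM2l //; have := P_ge2; lra.
Qed.

(** A pole of order [A] at the root is divided by [p] at each level, until only the
    contribution of [c] is left. *)
Lemma deep_levels : exists m0, forall k z,
  iter (m0 + k) f z = a -> ((- (1 + q))%:E < v z)%E.
Proof.
have [A A0 vA] : exists2 A : R, 0 <= A & ((- A)%:E <= v a)%E.
  have [->|a0] := eqVneq a 0; first by exists 0; rewrite // (valu0 v_val) leey.
  have [r ->] := valu_fin v_val a0; exists `|r| => //.
  by rewrite lee_fin lerNl -normrN ler_norm.
have shrink k z : iter k f z = a -> ((- (A / P ^+ k + q))%:E <= v z)%E.
  elim: k z => [|k IHk] z.
    by move=> /= ->; apply: le_trans vA; rewrite lee_fin expr0 divr1; have := q_gt0; lra.
  rewrite iterSr => /IHk hf.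
  have Ak0 : 0 <= A / P ^+ k by rewrite divr_ge0 // exprn_ge0; have := q_gt0; have := P_ge2; lra.
  have hz : ((- (A / P ^+ k + (1 + q)))%:E <= v (z ^+ p)%R)%E.
    rewrite -[z ^+ p](subrK c); apply: (valuD v_val).
      by apply: le_trans hf; rewrite lee_fin; have := q_gt0; lra.
    by rewrite v_c lee_fin; have := q_gt0; lra.
  have [->|z0] := eqVneq z 0; first by rewrite (valu0 v_val) leey.
  have [r vr] := valu_fin v_val z0; move: hz.
  rewrite (valuX v_val _ vr) vr !lee_fin => hz.
  rewrite -(ler_pM2l (x := P)); last by have := q_gt0; have := P_ge2; lra.
  apply: le_trans hz; rewrite mulrN mulrDr Pq exprS invfM.
  have -> : P * (A * (P^-1 * (P ^+ k)^-1)) = A / P ^+ k.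
    by field; rewrite expf_neq0 /=; apply: lt0r_neq0; have := q_gt0; have := P_ge2; lra.
  by have := q_gt0; lra.
pose m0 := Num.bound A.
have hm0 : A / P ^+ m0 < 1.
  rewrite ltr_pdivrMr ?mul1r; last by rewrite exprn_gt0 //; have := q_gt0; have := P_ge2; lra.
  apply: (lt_trans (archi_boundP A0)); rewrite -/m0 -natrX ltr_nat.
  by apply: ltn_expl; apply: prime_gt1.
exists m0; elim=> [|k IHk] z.
  by rewrite addn0 => /shrink; apply: lt_le_trans; rewrite lte_fin; have := q_gt0; lra.
by rewrite addnS iterSr => /IHk /good_child; apply: good_gt.
Qed.

(** The graph of an inertia element acting on a subfield that contains the first
    [n] levels of the tree, as a relation on the algebraic closure: the pairs of
    [moved_pairs] can then be chosen before the subfield. *)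
Definition partial_automorphism (S : F -> F -> Prop) (n : nat) :=
  [/\ forall z x y, S z x -> S z y -> x = y,
      forall z z' u u', S z z' -> S u u' -> S (z - u) (z' - u'),
      forall z z' u u', S z z' -> S u u' -> S (z * u) (z' * u') &
      forall z z', S z z' -> S z^-1 z'^-1] /\
  [/\ S 1 1, S a a, S c c, (forall m z, (m <= n)%N -> iter m f z = a -> exists z', S z z') &
      (forall z z', S z z' -> 0 <= v z -> 0 < v (z' - z)%R)%E].

(** The pairs of integral elements, of bounded total distance, that detect inertia.
    All pairs of vertices of one deep level [m0], made integral by the factor
    [p ^ 2], detect what moves that level.  Above each of these vertices [j] choose
    one branch [br j].  An element that fixes [br j k] and moves [br j k.+1] sends
    it to a sibling; it then moves the inverse of [del j k], because
    [del j k] cannot be integral, siblings being at distance [0].  As [v (del j k)]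
    is at least [- (1 + q) / p ^ k], the inverses are within [w2 k], which decreases
    geometrically, and there are at most [p] siblings.  Finally an element that
    fixes the branches fixes every vertex above: the distance of a vertex to its
    branch is integral, so inertia changes it by a positive amount and cannot
    exchange siblings. *)
Lemma moved_pairs (levels : forall m, exists J : seq F, forall z, iter m f z = a <-> z \in J) :
  exists m0, exists2 B : R, 0 <= B & forall N, exists T : seq (F * F * R),
    [/\ forall t, t \in T -> [/\ (0 <= v t.1.1)%E, (0 <= v t.1.2)%E,
          t.1.1 != t.1.2 & (v (t.1.2 - t.1.1)%R <= t.2%:E)%E],
        \sum_(t <- T) t.2 <= B &
        forall S, partial_automorphism S (m0 + N) ->
          (forall z, iter (m0 + N) f z = a -> S z z) \/
          exists2 t, t \in T & S t.1.1 t.1.2].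
Proof.
have p0 := prime_gt0 p_prime.
have [m0 deep] := deep_levels; exists m0.
have {levels} [J hJ] := levels m0.
have good_deep k z : iter (m0 + k.+1) f z = a -> good z.
  by rewrite addnS iterSr => /deep; apply: good_child.
have /choice[rs hrs] (b : F) : exists s : seq F, size s = p /\ forall z, f z = b -> z \in s.
  have [s hs] := closed_field_poly_normal ('X^p - (b + c)%:P : {poly F}).
  have mon : 'X^p - (b + c)%:P \is monic by apply: monicXnsubC.
  rewrite (monicP mon) scale1r in hs; exists s; split.
    by have := size_prod_XsubC s id; rewrite -hs size_XnsubC // => -[].
  move=> z fz; have : root ('X^p - (b + c)%:P) z.
    by rewrite /root !hornerE -fz /unicritical subrK subrr.
  by rewrite hs root_prod_XsubC.
have /choice[pre hpre] (b : F) : exists z, f z = b.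
  have /closed_rootP[z] : size ('X^p - (b + c)%:P) != 1.
    by rewrite size_XnsubC //; case: (p) p_prime.
  rewrite /root !hornerE subr_eq0 => /eqP fz.
  by exists z; rewrite /unicritical fz addrK.
pose br j k := iter k pre j.
have brS j k : f (br j k.+1) = br j k by rewrite /br /= hpre.
have br_iter j k : iter k f (br j k) = j.
  by elim: k => // k IHk; rewrite iterSr brS.
have br_level j k : j \in J -> iter (m0 + k) f (br j k) = a.
  by move=> /hJ; rewrite iterD br_iter.
have br_good j k : j \in J -> good (br j k.+1).
  by move=> jJ; apply: good_deep (br_level j k.+1 jJ).
pose del j k := br j k.+1 - br j k.
have del_ge j k : j \in J -> ((- ((1 + q) / P ^+ k))%:E <= v (del j k))%E.
  move=> jJ; elim: k => [|k IHk].
    rewrite expr0 divr1; apply: (valuB v_val); apply: ltW.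
      by apply: (deep 1%N); apply: br_level.
    by apply: (deep 0%N); apply: br_level.
  have t0 : 0 <= (1 + q) / P ^+ k.+1.
    by rewrite divr_ge0 ?exprn_ge0 //; have := q_gt0; lra.
  rewrite /del; apply: (child_dist t0 (br_good j k jJ)).
  rewrite !brS; apply: le_trans IHk; rewrite lee_fin exprS invfM.
  by rewrite mulrCA mulVKf // pnatr_eq0 -lt0n.
pose w2 k : R := 2 * ((1 + q) / P ^+ k).
have w2_ge0 k : 0 <= w2 k.
  by rewrite /w2 mulr_ge0 // divr_ge0 ?exprn_ge0 //; have := q_gt0; lra.
pose s2 z : F := p%:R * p%:R * z.
(* In each candidate the third component is the intended bound on the distance of
   the other two; the candidates satisfying [ok] are kept in the end. *)
pose T0 := [seq (s2 z, s2 z', `|fine (v (s2 z' - s2 z)%R)|) | z <- J, z' <- J].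
pose T1 N := [seq ((del jk.1 jk.2)^-1, (z' - br jk.1 jk.2)^-1, w2 jk.2)
   | jk <- [seq (j, k) | j <- J, k <- iota 0 N], z' <- rs (br jk.1 jk.2)].
pose ok (t : F * F * R) := [/\ (0 <= v t.1.1)%E, (0 <= v t.1.2)%E,
          t.1.1 != t.1.2 & (v (t.1.2 - t.1.1)%R <= t.2%:E)%E].
pose B0 := \sum_(t <- T0) t.2.
have B0_ge0 : 0 <= B0.
  by rewrite /B0 big_allpairs_dep; apply: sumr_ge0 => z _; apply: sumr_ge0 => z' _ /=.
pose B1 := (size J)%:R * (P * (4 * (1 + q))).
have B1_ge0 : 0 <= B1 by rewrite /B1 !mulr_ge0 //; have := q_gt0; lra.
have geom N : \sum_(k <- iota 0 N) w2 k <= 4 * (1 + q).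
  have -> : iota 0 N = index_iota 0 N by rewrite /index_iota subn0.
  apply: (@le_trans _ _ (4 * (1 + q) * (1 - (P ^+ N)^-1))); last first.
    rewrite ler_piMr ?gerBl ?invr_ge0 ?exprn_ge0 //.
    by have := q_gt0; lra.
  elim: N => [|N IHN]; first by rewrite big_geq // expr0 invr1 subrr mulr0.
  rewrite big_nat_recr //=; apply: (le_trans (lerD IHN (lexx _))).
  rewrite /w2 exprS invfM; set x := (P ^+ N)^-1.
  have x0 : 0 <= (1 + q) * x.
    by rewrite mulr_ge0 ?invr_ge0 ?exprn_ge0 //; have := q_gt0; lra.
  have hP : P^-1 <= 2^-1 by rewrite lef_pV2 ?posrE //; have := P_ge2; lra.
  have := ler_wpM2l x0 hP; lra.
have sumT1 N : \sum_(t <- T1 N) t.2 <= B1.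
  rewrite /T1 big_allpairs_dep /= big_allpairs_dep /=.
  rewrite /B1 -sum1_size natr_sum mulr_suml; apply: ler_sum => j _.
  rewrite mul1r; apply: le_trans (ler_wpM2l _ (geom N)); last by have := P_ge2; lra.
  rewrite mulr_sumr; apply: ler_sum => k _.
  by rewrite big_const_seq count_predT (hrs _).1 iter_addr_0 -[leLHS]mulr_natl.
exists (B0 + B1); first exact: addr_ge0.
move=> N; exists [seq t <- T0 ++ T1 N | `[< ok t >]]; split.
- by move=> t; rewrite mem_filter => /andP[/asboolP].
- rewrite big_filter big_mkcond /= big_cat /=; apply: lerD.
    rewrite /B0 /T0 !big_allpairs_dep; apply: ler_sum => z _; apply: ler_sum => z' _ /=.
    by case: asboolP.
  apply: le_trans (sumT1 N); rewrite /T1 !big_allpairs_dep.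
  apply: ler_sum => j _; apply: ler_sum => k _; apply: ler_sum => z' _ /=.
  by case: asboolP.
move=> S [[S_fun SB SM SV] [S1 Sa Sc S_tot S_inert]].
have SX z z' n : S z z' -> S (z ^+ n) (z' ^+ n).
  by move=> Sz; elim: n => [|n IHn]; rewrite ?expr0 // !exprS; apply: SM.
have Sf z z' : S z z' -> S (f z) (f z') by move=> Sz; apply: SB => //; apply: SX.
have S0 : S 0 0 by rewrite -(subrr 1); apply: SB.
have SN z z' : S z z' -> S (- z) (- z').
  by move=> Sz; rewrite -[- z]add0r -[- z']add0r; apply: SB.
have Snat n : S n%:R n%:R.
  elim: n => // n IHn; rewrite -natr1 -[_ + 1]opprK opprD.
  by apply/SN/SB => //; apply: SN.
have S_iter m z z' : S z z' -> S (iter m f z) (iter m f z').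
  by move=> Sz; elim: m => //= m IHm; apply: Sf.
have [fixJ|] := pselect (forall z, z \in J -> S z z); last first.
  move=> nfix; right.
  have [z [zJ nSz]] : exists z, z \in J /\ ~ S z z.
    by apply: contrapT => hn; apply: nfix => z zJ; apply: contrapT => h; apply: hn; exists z.
  have za := (hJ z).2 zJ.
  have [z' Szz'] := S_tot m0 z (leq_addr _ _) za.
  have zz' : z != z' by apply/eqP => e; apply: nSz; rewrite {2}e.
  have z'J : z' \in J.
    by apply/hJ; apply: (S_fun (iter m0 f z)); [apply: S_iter | rewrite za].
  have s2_int u : u \in J -> (0 <= v (s2 u))%E.
    move=> uJ; have := deep 0%N u; rewrite addn0 => /(_ ((hJ u).2 uJ)) /ltW hu.
    apply: (@le_trans _ _ ((1 + 1) + (- (1 + q)))%:E); last first.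
      by apply: (valuM_ge v_val) => //; rewrite (valuM v_val) v_p.
    rewrite lee_fin; have := P_ge2; have := Pq; have := q_gt0; nra.
  exists (s2 z, s2 z', `|fine (v (s2 z' - s2 z)%R)|) => /=.
    rewrite mem_filter mem_cat; apply/andP; split; last first.
      by apply/orP; left; apply/allpairsP; exists (z, z').
    have s20 : s2 z != s2 z'.
      rewrite /s2; apply: contra zz' => /eqP/mulfI h; apply/eqP/h.
      by apply: mulf_neq0; apply: valu_neq0 v_p.
    apply/asboolP; split=> //=; try exact: s2_int.
    have d0 : s2 z' - s2 z != 0 by rewrite subr_eq0 eq_sym.
    by have [r ->] := valu_fin v_val d0; rewrite /= lee_fin ler_norm.
  exact: SM _ _ _ _ (SM _ _ _ _ (Snat p) (Snat p)) Szz'.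
(* All branches are fixed up to level [m0 + N]: every vertex of that level is
   fixed. *)
have [fixbr|] := pselect (forall j k, j \in J -> (k <= N)%N -> S (br j k) (br j k)).
  left=> z hz; have jJ : iter N f z \in J by apply/hJ; rewrite -iterD.
  move: jJ; set j := iter N f z => jJ.
  suff H k u : (k <= N)%N -> iter k f u = j -> (0 <= v (u - br j k)%R)%E /\ S u u.
    by case: (H N z (leqnn N) erefl).
  elim: k u => [|k IHk] u kN.
    by move=> /= ->; rewrite subrr (valu0 v_val) leey; split=> //; apply: fixJ.
  rewrite iterSr => hu; have [hd Sfu] := IHk _ (ltnW kN) hu.
  have gu : good u by apply: (good_deep k); rewrite iterD iterSr hu; apply/hJ.
  have ud : (0 <= v (u - br j k.+1)%R)%E.
    have := child_dist (lexx 0) (br_good j k jJ) (z' := u).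
    by rewrite mulr0 oppr0 brS; apply.
  split=> //.
  have ua : iter (m0 + k.+1) f u = a by rewrite iterD iterSr hu; apply/hJ.
  have [|u' Su] := S_tot (m0 + k.+1)%N u _ ua; first by rewrite leq_add2l.
  have fu' : f u' = f u by apply: (S_fun (f u)) => //; apply: Sf.
  have [e|u'u] := eqVneq u' u; first by rewrite -{2}e.
  have := S_inert _ _ (SB _ _ _ _ Su (fixbr j k.+1 jJ kN)) ud.
  have -> : u' - br j k.+1 - (u - br j k.+1) = u' - u by ring.
  by rewrite (siblings_dist gu fu' u'u) ltxx.
move=> nfix; right.
(* The first vertex of a branch that moves. *)
have [j [k [jJ kN Sk nSk]]] : exists j, exists k,
    [/\ j \in J, (k < N)%N, S (br j k) (br j k) & ~ S (br j k.+1) (br j k.+1)].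
  apply: contrapT => hn; apply: nfix => j k jJ; elim: k => [|k IHk] kN; first exact: fixJ.
  apply: contrapT => h; apply: hn; exists j; exists k; split=> //.
  exact/IHk/ltnW.
have [|z' Sz'] := S_tot (m0 + k.+1)%N (br j k.+1) _ (br_level j k.+1 jJ).
  by rewrite leq_add2l.
have fz' : f z' = br j k.
  by apply: (S_fun (br j k)) => //; rewrite -{1}(brS j k); apply: Sf.
have zz' : z' != br j k.+1 by apply/eqP => e; apply: nSk; rewrite -{2}e.
have sib : v (z' - br j k.+1)%R = 0%E.
  by apply: siblings_dist => //; [exact: br_good | rewrite fz' brS].
have Sd : S (del j k) (z' - br j k) by apply: SB.
have dd : z' - br j k - del j k = z' - br j k.+1 by rewrite /del; ring.
(* An integral difference would move by a positive amount, and siblings are at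
   distance [0]. *)
have d_neg : (v (del j k) < 0)%E.
  rewrite ltNge; apply/negP => h.
  by have := S_inert _ _ Sd h; rewrite dd sib ltxx.
have [r vr] : exists r : R, v (del j k) = r%:E.
  by apply: (valu_fin v_val); apply: contraTneq d_neg => ->; rewrite (valu0 v_val).
have r0 : r < 0 by move: d_neg; rewrite vr lte_fin.
have vd' : v (z' - br j k)%R = r%:E.
  rewrite -vr; have -> : z' - br j k = del j k + (z' - br j k.+1) by rewrite -dd; ring.
  by rewrite (valuD_eq v_val) // sib.
exists ((del j k)^-1, (z' - br j k)^-1, w2 k) => /=; last exact: SV.
rewrite mem_filter mem_cat; apply/andP; split; last first.
  apply/orP; right; apply/allpairsPdep; exists (j, k), z'; split=> //=.
    by apply/allpairsP; exists (j, k); rewrite mem_iota.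
  by apply: (hrs _).2.
have d0 := valu_neq0 v_val vr; have d'0 := valu_neq0 v_val vd'.
apply/asboolP; split=> /=.
- by rewrite (valuV v_val vr) lee_fin; lra.
- by rewrite (valuV v_val vd') lee_fin; lra.
- by rewrite (inj_eq invr_inj) eq_sym -subr_eq0 dd subr_eq0.
have -> : (z' - br j k)^-1 - (del j k)^-1 =
    - (z' - br j k.+1) * ((z' - br j k)^-1 * (del j k)^-1).
  by rewrite -dd; field; rewrite d0 d'0.
rewrite !(valuM v_val) (valuN v_val) sib (valuV v_val vr) (valuV v_val vd').
rewrite add0e -EFinD lee_fin.
by have := del_ge j k jJ; rewrite vr lee_fin /w2; lra.
Qed.

End Tree.

(** * Splitting fields inside an algebraically closed field *)

Section SplittingSubfield.
Variables (K : fieldType) (Kbar : closedFieldType) (iota : {rmorphism K -> Kbar}).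
Hypotheses (K_char0 : [pchar K] =i pred0) (Kbar_alg : algebraic_closure iota).

(** By induction on [s], from the primitive element theorem for two elements; the
    explicit form of [z] shows that it lies in every ring containing [s]. *)
Lemma primitive_element (s : seq Kbar) : exists z : Kbar,
  (exists a : seq nat, z = \sum_(i < size s) s`_i *+ (nth 0%N a i))
  /\ exists ps : seq {poly K}, s = [seq (map_poly iota q).[z] | q <- ps].
Proof.
elim: s => [|x s [z [[a Dz] [ps Ds]]]].
  by exists 0; split; [exists [::]; rewrite big_ord0 | exists nil].
have [rx nz_rx rx0] := Kbar_alg x.
have [rz nz_rz rz0] := Kbar_alg (- z).
have [n [[pz Dpz] [px Dpx]]] := pchar0_PET nz_rz rz0 nz_rx rx0 K_char0.
rewrite opprK in Dpz Dpx; exists (x *+ n + z); split.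
  by exists (n :: a); rewrite /= big_ord_recl /= Dz.
exists (px :: [seq q \Po (- pz) | q <- ps]); rewrite /= Dpx; congr (_ :: _).
rewrite -map_comp {1}Ds; apply: eq_map => q /=.
by rewrite map_comp_poly horner_comp rmorphN hornerN Dpz opprK.
Qed.

(** The splitting field of [P] is built as the simple extension generated by a
    primitive element, which comes with an embedding; its image is the least
    division subring that contains the roots and the base field. *)
Lemma splitting_subfield (P : {poly K}) (s : seq Kbar) :
    uniq s -> P != 0 ->
    map_poly iota P = lead_coef (map_poly iota P) *: \prod_(z <- s) ('X - z%:P) ->
  exists L : splittingFieldType K, exists emb : {rmorphism L -> Kbar},
    [/\ galois 1 {:L}, forall k : K, emb k%:A = iota k,
        forall z, z \in s -> range emb z &
        forall S : set Kbar, GRing.divring_closed (fun z => z \in S) ->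
          range iota `|` [set` s] `<=` S -> range emb `<=` S].
Proof.
move=> s_uniq P0 DP; have [z [[a Dz] [ps Ds]]] := primitive_element s.
have [L [emb [embK [z1 z1C z1gen]]]] : exists L : fieldExtType K,
    exists emb : {rmorphism L -> Kbar}, (forall k : K, emb k%:A = iota k) /\
    exists2 z1 : L, emb z1 = z & forall x, exists q, x = (map_poly (in_alg L) q).[z1].
  have [r0 nz_r0 r0z] := Kbar_alg z.
  have [r [irr_r rz]] : exists r : {poly K}, irreducible_poly r /\ root (map_poly iota r) z.
    pose Q n := `[< exists r : {poly K}, [/\ r != 0, root (map_poly iota r) z & size r = n] >].
    have exQ : exists n, Q n by exists (size r0); apply/asboolP; exists r0.
    have [n /asboolP[r [nz_r rz szr]] min_n] := ex_minnP exQ.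
    exists r; split=> //; apply/(subfx_irreducibleP rz nz_r) => r1 r1z nz_r1.
    by rewrite szr min_n //; apply/asboolP; exists r1.
  have nz_r := irredp_neq0 irr_r.
  exists (SubFieldExtType rz irr_r), (@subfx_inj _ _ iota z r); split.
    by move=> k; exact: (subfx_inj_base rz nz_r k).
  exists (subfx_root iota z r); first exact: subfx_inj_root.
  by move=> x; have [q ->] := subfxEroot rz nz_r x; exists q.
have embE q : emb (map_poly (in_alg L) q).[z1] = (map_poly iota q).[z].
  rewrite -horner_map /= z1C -map_poly_comp; congr (_.[_]).
  by apply: eq_map_poly => k /=; rewrite embK.
pose s1 : seq L := [seq (map_poly (in_alg L) q).[z1] | q <- ps].
have Ds1 : map emb s1 = s.
  by rewrite /s1 -map_comp [RHS]Ds; apply: eq_map => q /=; rewrite embE.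
have s1_uniq : uniq s1 by rewrite -(map_inj_uniq (fmorph_inj emb)) Ds1.
have sz_s1 : size s1 = size s by rewrite -Ds1 [RHS]size_map.
have s1E k : (k < size s)%N -> emb s1`_k = s`_k.
  by move=> ks; rewrite -Ds1; apply: esym; apply: nth_map; rewrite sz_s1.
have genL : <<1 & s1>>%VS = fullv.
  apply/vspaceP=> x; rewrite memvf; have [q {x}->] := z1gen x.
  have z1E : z1 = \sum_(i < size s) s1`_i *+ (nth 0%N a i).
    apply: (fmorph_inj emb); rewrite z1C Dz rmorph_sum; apply: eq_bigr => i _.
    by rewrite rmorphMn /= s1E.
  have z1in : z1 \in <<1 & s1>>%VS.
    rewrite z1E memv_suml // => i _.
    by rewrite rpredMn ?seqv_sub_adjoin ?mem_nth // sz_s1.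
  apply: rpred_horner => //; apply/polyOverP => i.
  by rewrite coef_map /= rpredZ // mem1v.
pose P1 := map_poly (in_alg L) P.
have nz_l : lead_coef P1 != 0 by rewrite lead_coef_eq0 map_poly_eq0.
have DP1 : P1 = lead_coef P1 *: \prod_(y <- s1) ('X - y%:P).
  apply: (map_poly_inj emb); rewrite map_polyZ rmorph_prod /=.
  have -> : map_poly emb P1 = map_poly iota P.
    by rewrite -map_poly_comp; apply: eq_map_poly => k /=; rewrite embK.
  rewrite [LHS]DP !lead_coef_map /= embK; congr (_ *: _).
  rewrite -Ds1 big_map; apply: eq_bigr => y _.
  by rewrite rmorphB /= map_polyX map_polyC.
have P1over : P1 \is a polyOver 1%VS.
  by apply/polyOver1P; exists P.
have splitP1 : splittingFieldFor 1 P1 {:L}.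
  by exists s1 => //; rewrite DP1 eqp_scale.
have sepP1 : separable_poly P1.
  rewrite DP1 (eqp_separable (eqp_scale _ nz_l)) separable_prod_XsubC //.
have L_ax : FieldExt_isSplittingField _ L by constructor; exists P1.
pose L' : splittingFieldType K := HB.pack_for (splittingFieldType K) L L_ax.
exists L', emb; split=> //.
- by apply/splitting_galoisField; exists P1.
- by move=> x; rewrite -Ds1 => /mapP[y _ ->]; exists y.
move=> S S_div sub _ [x _ <-]; have [q ->] := z1gen x; rewrite embE.
have [S1 SB SV] := S_div.
have S1' : S 1 by apply/set_mem.
have SB' u t : S u -> S t -> S (u - t).
  by move=> Su St; apply/set_mem; apply: SB; apply/mem_set.
have SV' u t : S u -> S t -> S (u / t).
  by move=> Su St; apply/set_mem; apply: SV; apply/mem_set.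
have S0 : S 0 by rewrite -(subrr 1); apply: SB'.
have SD u t : S u -> S t -> S (u + t).
  by move=> Su St; rewrite -[t]opprK -[- t]add0r; apply: (SB') => //; apply: SB'.
have SM u t : S u -> S t -> S (u * t).
  by move=> Su St; rewrite -[t]invrK -[t^-1]mul1r; apply: (SV') => //; apply: SV'.
have Sz : S z.
  rewrite Dz; elim/big_ind: _ => // i _.
  elim: (nth 0%N a i) => [|n IHn]; rewrite ?mulr0n // mulrS; apply: SD => //.
  by apply: sub; right; rewrite /= mem_nth.
elim/poly_ind: q => [|q k IHq]; first by rewrite map_poly0 horner0.
rewrite rmorphD rmorphM /= map_polyX map_polyC !hornerE /=.
by apply: SD; [apply: SM | apply: sub; left; exists k].
Qed.

End SplittingSubfield.

(** * The Herbrand function of a finite level of the tower *)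

Lemma valuation_scale (R : realType) (F L : fieldType) (v : F -> \bar R) (E : R)
    (emb : {rmorphism L -> F}) : valuation v -> 0 < E ->
  valuation (fun x => (E%:E * v (emb x))%E).
Proof.
move=> v_val E0; split=> [x|x|x y|x y].
- split=> [h|->]; last by rewrite rmorph0 (valu0 v_val) gt0_muley ?lte_fin.
  apply/eqP; rewrite -(fmorph_eq0 emb); apply/negPn/negP => /(valu_fin v_val)[r vr].
  by move: h; rewrite vr.
- have [->|x0] := eqVneq x 0; first by rewrite rmorph0 (valu0 v_val) gt0_muley ?lte_fin.
  have [r ->] : exists r : R, v (emb x) = r%:E by apply: (valu_fin v_val); rewrite fmorph_eq0.
  by [].
- rewrite rmorphM (valuM v_val).
  rewrite muleDr //; case: v_val => _ nNy _ _.
  by move: (nNy (emb x)) (nNy (emb y)); case: (v (emb x)); case: (v (emb y)).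
have hm a b : (E%:E * Order.min a b = Order.min (E%:E * a) (E%:E * b))%E.
  by apply: mine_pMr => //; rewrite lee_fin ltW.
rewrite -hm rmorphD; apply: lee_wpmul2l; first by rewrite lee_fin ltW.
by case: v_val.
Qed.

Section FiniteLevel.
Variables (R : realType) (p : nat) (p_prime : prime p).
Variables (Qp : fieldType) (vp : Qp -> \bar R) (Qp_def : padic_completion p vp).
Variables (K : fieldExtType Qp).
Variables (Kbar : closedFieldType) (iota : {rmorphism K -> Kbar}).
Variables (v : Kbar -> \bar R) (v_val : valuation v).
Hypothesis v_ext : forall x : Qp, v (iota x%:A) = vp x.
Variables (L : splittingFieldType K) (emb : {rmorphism L -> Kbar}).
Hypotheses (L_gal : galois 1 {:L}) (embK : forall k : K, emb k%:A = iota k).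

Let j : {rmorphism Qp -> Kbar} := iota \o in_alg K.

Lemma valu_ext_p : v p%:R = 1%:E.
Proof. by rewrite -(rmorph_nat j) v_ext (padic_val_p p_prime Qp_def). Qed.

Lemma Kbar_char0 n : (0 < n)%N -> n%:R != 0 :> Kbar.
Proof.
move=> n0; rewrite -(rmorph_nat j); apply/eqP => e.
have := v_ext n%:R; rewrite -[iota _]/(j n%:R) e (valu0 v_val).
case: Qp_def => _ /(_ n%:R) + _ _; rewrite ratr_nat => ->.
by rewrite /padic_val pnatr_eq0 eqn0Ngt n0.
Qed.

Lemma annihilator_K (z : K) : exists P : {poly Qp},
  [/\ P != 0, root (map_poly j P) (iota z) & (size P <= (\dim {:K}).+1)%N].
Proof.
have [P [P0 Pz szP]] := fieldExt_annihilator z; exists P; split=> //.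
by rewrite map_poly_comp fmorph_root.
Qed.

Let L0 : fieldExtType Qp := baseFieldType L.

Lemma emb_base (x : Qp) : emb (x%:A : L0) = j x.
Proof. by rewrite baseField_scaleE embK. Qed.

Lemma annihilator_L (x : L) : exists P : {poly Qp},
  [/\ P != 0, root (map_poly j P) (emb x) & (size P <= (\dim {:L0}).+1)%N].
Proof.
have [P [P0 Px szP]] := fieldExt_annihilator (x : L0); exists P; split=> //.
have -> : map_poly j P = map_poly emb (map_poly (in_alg L0) P : {poly L}).
  rewrite -map_poly_comp; apply: eq_map_poly => t /=.
  by rewrite -[RHS]/(emb (t%:A : L0)) emb_base.
by rewrite fmorph_root.
Qed.

(** The two sides extend the p-adic valuation to [L], so they agree. *)
Lemma emb_gal (s : gal_of {:L}) x : v (emb (s x)) = v (emb x).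
Proof.
pose v1 (x : L0) := v (emb (s x)); pose v2 (x : L0) := v (emb x).
have h1 : valuation v1.
  split=> [y|y|y t|y t]; rewrite /v1.
  - split=> [/(valu_eqy v_val)/eqP|->]; last by rewrite raddf0 rmorph0 (valu0 v_val).
    by rewrite !fmorph_eq0 => /eqP.
  - by case: v_val.
  - by rewrite !rmorphM (valuM v_val).
  - by rewrite raddfD rmorphD; case: v_val.
have h2 : valuation v2.
  split=> [y|y|y t|y t]; rewrite /v2.
  - split=> [/(valu_eqy v_val)/eqP|->]; last by rewrite rmorph0 (valu0 v_val).
    by rewrite !fmorph_eq0 => /eqP.
  - by case: v_val.
  - by rewrite !rmorphM (valuM v_val).
  - by rewrite rmorphD; case: v_val.
apply: (valu_ext_unique p_prime Qp_def h1 h2) => t.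
  rewrite /v1 baseField_scaleE linearZ /= rmorph1 -baseField_scaleE.
  by rewrite emb_base v_ext.
by rewrite /v2 emb_base v_ext.
Qed.

(** The value group lies in the multiples of [1 / N], so it is generated by its
    least positive element [k / N]. *)
Lemma normalization : exists2 E : R, 0 < E &
  normalized_valuation (fun x : L => (E%:E * v (emb x))%E).
Proof.
pose N := (\dim {:L0})`!.
have N0 : 0 < N%:R :> R by rewrite ltr0n fact_gt0.
have valE x : x != 0 -> exists m : int, v (emb x) = (m%:~R / N%:R)%:E.
  move=> x0; have [P [P0 Px szP]] := annihilator_L x.
  apply: (valu_denominator p_prime Qp_def v_val (j := j) v_ext P0 Px szP).
  by rewrite fmorph_eq0.
pose A k := (0 < k)%N && `[< exists x, v (emb x) = (k%:R / N%:R)%:E >].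
have exA : exists k, A k.
  exists N; rewrite /A fact_gt0 /=; apply/asboolP; exists p%:R.
  by rewrite rmorph_nat valu_ext_p divff // gt_eqF.
have [k /andP[k0 /asboolP[z vz]] min_k] := ex_minnP exA.
have kR : 0 < k%:R :> R by rewrite ltr0n.
have E0 : 0 < (N%:R / k%:R : R) by rewrite divr_gt0.
exists (N%:R / k%:R) => //; split; first exact: valuation_scale.
have z0 : z != 0 by rewrite -(fmorph_eq0 emb); apply: valu_neq0 vz.
apply/seteqP; split=> [_ [x /= x0 <-]|_ [m _ <-]].
  have [m vx] := valE x x0; rewrite vx.
  have kz : k%:Z != 0 by rewrite eqz_nat -lt0n.
  have vy : v (emb (x * z ^ (- (m %/ k)%Z)))%R = (`|(m %% k)%Z|%:R / N%:R)%:E.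
    rewrite rmorphM fmorphXz (valuM v_val) vx (valuXz _ v_val vz) -EFinD.
    congr (_%:E); rewrite natr_absz ger0_norm ?modz_ge0 //.
    rewrite mulrA -mulrDl {1}(divz_eq m k) rmorphD rmorphM rmorphN /= -pmulrn.
    by congr (_ / _); ring.
  have r0 : (m %% k)%Z = 0.
    apply/eqP; rewrite -absz_eq0 -[_ == 0%N]negbK -lt0n; apply/negP => r_gt0.
    have : (k <= `|(m %% k)%Z|)%N.
      apply: min_k; rewrite /A r_gt0 /=.
      by apply/asboolP; exists (x * z ^ (- (m %/ k)%Z)).
    have := ltz_pmod m (d := k%:Z); rewrite ltz_nat k0 => /(_ isT).
    by have := modz_ge0 m kz; lia.
  exists (m %/ k)%Z => //; rewrite -EFinM; congr (_%:E).
  rewrite [in RHS](divz_eq m k) r0 addr0 rmorphM /= -pmulrn.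
  by field; rewrite !gt_eqF.
exists (z ^ m) => /=; first by rewrite expfz_neq0.
rewrite fmorphXz (valuXz _ v_val vz) -EFinM; congr (_%:E).
by field; rewrite !gt_eqF.
Qed.

Lemma gal_partial_automorphism (a c : K) (s : gal_of {:L}) n :
    (forall x, 0 <= v (emb x) -> 0 < v (emb (s x) - emb x)%R)%E ->
    (forall m z, (m <= n)%N -> iter m (unicritical p (iota c)) z = iota a ->
       range emb z) ->
  partial_automorphism p v (iota a) (iota c)
    (fun z z' => exists2 x, emb x = z & emb (s x) = z') n.
Proof.
move=> s_inert s_range.
have Skk (k : K) : exists2 x, emb x = iota k & emb (s x) = iota k.
  by exists k%:A; rewrite ?linearZ /= ?rmorph1 embK.
split; split => //.
- by move=> z _ _ [x <- <-] [y /(fmorph_inj emb) -> <-].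
- move=> _ _ _ _ [x <- <-] [y <- <-]; exists (x - y); first by rewrite rmorphB.
  by rewrite !raddfB.
- move=> _ _ _ _ [x <- <-] [y <- <-]; exists (x * y); first by rewrite rmorphM.
  by rewrite !rmorphM.
- by move=> _ _ [x <- <-]; exists x^-1; rewrite ?fmorphV.
- by have := Skk 1; rewrite rmorph1.
- by move=> m z mn hz; have [x _ <-] := s_range m z mn hz; exists (emb (s x)), x.
- by move=> _ _ [x <- <-]; apply: s_inert.
Qed.

(** Each nontrivial inertia element is counted by some triple of [T], so
    [inertia_sum_le] bounds the sum of the [w (t pi - pi)] by [E * B]; the same
    triples bound the last break [u] by [E * B].  Hence [herbrand_le] gives
    [herbrand w u * #|G0| <= 2 * E * B], and [E] is at most
    [[K : Qp]! * #|G0|]. *)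
Lemma herbrand_bound (T : seq (Kbar * Kbar * R)) (B : R) :
    (forall t, t \in T -> [/\ (0 <= v t.1.1)%E, (0 <= v t.1.2)%E,
          t.1.1 != t.1.2 & (v (t.1.2 - t.1.1)%R <= t.2%:E)%E]) ->
    \sum_(t <- T) t.2 <= B ->
    (forall (s : gal_of {:L}), s != 1%g ->
       (forall x, 0 <= v (emb x) -> 0 < v (emb (s x) - emb x)%R)%E ->
       exists2 t, t \in T & exists2 x, emb x = t.1.1 & emb (s x) = t.1.2) ->
  exists2 w : L -> \bar R, normalized_valuation w &
    forall u (s : gal_of {:L}), 0 <= u -> s \in lower_ramif w u -> s != 1%g ->
      herbrand w u <= 2 * (\dim {:K})`!%:R * B.
Proof.
move=> T_ok T_sum T_cover; have [E E0 w_norm] := normalization.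
set w := (fun x : L => _) in w_norm; exists w => // u s u0 sGu s1.
have w_val : valuation w by case: w_norm.
have wE x (r : R) : v (emb x) = r%:E -> w x = (E * r)%:E.
  by move=> vx; rewrite /w vx.
have w_ge0 x : (0 <= w x)%E = (0 <= v (emb x))%E.
  by rewrite /w -[X in (X <= _)%E](mule0 E%:E) lee_pmul2l // lte_fin.
have w_gt0 x : (0 < w x)%E = (0 < v (emb x))%E.
  by rewrite /w -[X in (X < _)%E](mule0 E%:E) lte_pmul2l // lte_fin.
have w_gal (t : gal_of {:L}) x : w (t x) = w x by rewrite /w emb_gal.
have w_p : (1%:E <= w p%:R)%E.
  by apply: (normalized_ge1 w_norm); rewrite w_gt0 rmorph_nat valu_ext_p lte_fin.
have w_res x : (0 <= w x)%E -> exists2 m, (0 < m)%N & (0 < w (x ^+ (p ^ m) - x)%R)%E.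
  rewrite w_ge0 => x_int; have [P [P0 Px _]] := annihilator_L x.
  have [m m0 hm] := residue_finite_order p_prime Qp_def v_val (j := j) v_ext P0 Px x_int.
  by exists m; rewrite // w_gt0 rmorphB rmorphXn.
have [pi w_pi] := uniformizer_exists w_norm.
set G0 := lower_ramif w 0.
have cover t : t \in G0 -> t != 1%g ->
    exists2 q, q \in T & exists2 x, emb x = q.1.1 & emb (t x) = q.1.2.
  move=> tG t1; apply: T_cover => // x; rewrite -w_ge0 => x_int.
  rewrite -rmorphB -w_gt0; apply: lt_le_trans (inertiaB tG x_int).
  by rewrite lte_fin.
have T_ge0 q : q \in T -> 0 <= q.2.
  move=> /T_ok[h1 h2 _ h3]; rewrite -lee_fin; apply: le_trans h3.
  exact: (valuB v_val).
have T_le q : q \in T -> q.2 <= B.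
  move=> qT; apply: le_trans T_sum; rewrite (big_rem q) //= lerDl.
  by rewrite big_seq; apply: sumr_ge0 => t /mem_rem; apply: T_ge0.
have L_char n : (0 < n)%N -> n%:R != 0 :> L.
  by move=> n0; rewrite -(fmorph_eq0 emb) rmorph_nat Kbar_char0.
(* An element of [K] has value [#|G0|] for [w], and values of elements of [K] have
   the denominator [(\dim {:K})`!] for [v]. *)
have e_le : E <= (\dim {:K})`!%:R * #|G0|%:R.
  have [z wz] := card_inertia_value w_norm p_prime w_p w_res w_gal w_pi L_gal L_char.
  have G0_gt0 : 0 < #|G0|%:R :> R by rewrite ltr0n (cardG_gt0 (lower_ramif_group w_norm (lexx 0))).
  have z0 : iota z != 0.
    have : z%:A != 0 :> L by apply: valu_neq0 wz.
    by rewrite -(fmorph_eq0 emb) embK.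
  have [P [P0 Pz szP]] := annihilator_K z.
  have [m vm] := valu_denominator p_prime Qp_def v_val (j := j) v_ext P0 Pz szP z0.
  have d0 : 0 < (\dim {:K})`!%:R :> R by rewrite ltr0n fact_gt0.
  move: wz; rewrite (wE _ (m%:~R / (\dim {:K})`!%:R)) ?embK // => -[e].
  have e' : E * m%:~R = (\dim {:K})`!%:R * #|G0|%:R.
    by rewrite -e; field; rewrite gt_eqF.
  have m1 : 1 <= m%:~R :> R.
    have : 0 < E * m%:~R by rewrite e' mulr_gt0.
    by rewrite pmulr_rgt0 // ltr0z gtz0_ge1 -(ler_int R).
  by rewrite -e' ler_peMr // ltW.
have G0_gt0 : 0 < #|G0|%:R :> R by rewrite ltr0n (cardG_gt0 (lower_ramif_group w_norm (lexx 0))).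
pose i (t : gal_of {:L}) : R := fine (w (t pi - pi)%R).
have wi t : t \in G0 -> t != 1%g -> w (t pi - pi)%R = (i t)%:E.
  move=> tG t1; have [|r h] := @valu_fin _ _ w w_val (t pi - pi).
    rewrite subr_eq0; apply: contraNneq t1.
    by move/(uniformizer_faithful w_norm p_prime w_p w_res w_pi tG) => ->.
  by rewrite /i h.
have i_ge t r : 0 <= r -> t \in lower_ramif w r -> t != 1%g -> r <= i t.
  move=> r0 tG t1; have tG0 : t \in G0 by apply: (fintype.subsetP (lower_ramifS w r0)).
  have := lower_ramifP w r t tG pi; rewrite w_pi lee_fin ler01 => /(_ isT).
  by rewrite wi // lee_fin; apply: le_trans; rewrite lerDl.
have i_ge0 t : t \in G0 -> 0 <= i t.
  have [->|t1] := eqVneq t 1%g; first by rewrite /i gal_id subrr (valu0 w_val).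
  by move=> tG; apply: i_ge.
have sum_i : \sum_(t in G0 | t != 1%g) i t <= E * B.
  apply: (@le_trans _ _ (\sum_(q <- T) E * q.2)); last first.
    by rewrite -mulr_sumr ler_pM2l.
  pose hit (q : Kbar * Kbar * R) (t : gal_of {:L}) := `[< exists2 x, emb x = q.1.1 & emb (t x) = q.1.2 >].
  have step1 : \sum_(t in G0 | t != 1%g) i t <=
      \sum_(q <- T) \sum_(t in G0 | (t != 1%g) && hit q t) i t.
    rewrite (exchange_big_dep (fun t => (t \in G0) && (t != 1%g))) /=; last first.
      by move=> q t _ /and3P[-> ->].
    apply: ler_sum => t /andP[tG t1]; have [q qT hq] := cover t tG t1.
    rewrite (big_rem q) //= tG t1 /=.
    have -> : hit q t by apply/asboolP.
    by rewrite lerDl; apply: sumr_ge0 => q' _; apply: i_ge0.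
  apply: (le_trans step1).
  rewrite big_seq [leRHS]big_seq; apply: ler_sum => q qT.
  have [[x xq]|nx] := pselect (exists x, emb x = q.1.1); last first.
    rewrite big1 ?mulr_ge0 ?T_ge0 ?ltW // => t /and3P[_ _ /asboolP[x hx _]].
    by case: nx; exists x.
  have [[x' xq']|nx] := pselect (exists x, emb x = q.1.2); last first.
    rewrite big1 ?mulr_ge0 ?T_ge0 ?ltW // => t /and3P[_ _ /asboolP[y _ hy]].
    by case: nx; exists (t y).
  have [h1 h2 h3 h4] := T_ok q qT.
  have xx' : x != x' by apply: contraNneq h3 => e; rewrite -xq -xq' e.
  have := inertia_sum_le w_norm p_prime w_p w_res w_pi (y := x) (y' := x').
  rewrite !w_ge0 xq xq' => /(_ h1 h2 xx') h.
  have hw : (w (x' - x)%R <= (E * q.2)%:E)%E.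
    by rewrite /w rmorphB xq xq' EFinM lee_pmul2l // lte_fin.
  rewrite -lee_fin; apply: le_trans hw; apply: le_trans h.
  rewrite -sumEFin le_eqVlt; apply/orP; left; apply/eqP; apply: eq_big => t.
    case tG : (t \in G0) => //=; apply/idP/idP.
      move=> /andP[_ /asboolP[y yq ty]]; apply/eqP/(fmorph_inj emb).
      by rewrite -(fmorph_inj emb (etrans yq (esym xq))) ty.
    move=> /eqP tx; apply/andP; split.
      by apply: contra xx' => /eqP t1; rewrite -tx t1 gal_id.
    by apply/asboolP; exists x; rewrite // tx.
  by case/and3P => tG t1 _; rewrite wi.
have u_le : u <= E * B.
  have sG0 : s \in G0 by apply: (fintype.subsetP (lower_ramifS w u0)).
  have [q qT [x xq sxq]] := cover s sG0 s1; have [h1 h2 h3 h4] := T_ok q qT.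
  have := lower_ramifP w u s sGu x; rewrite w_ge0 xq => /(_ h1).
  rewrite /w rmorphB xq sxq => h.
  have : ((u + 1)%:E <= (E * q.2)%:E)%E.
    by apply: le_trans h _; rewrite EFinM lee_pmul2l // lte_fin.
  rewrite lee_fin => h5; have := T_le q qT => h6.
  apply: le_trans (ler_wpM2l (ltW E0) h6); apply: le_trans h5.
  by rewrite lerDl.
have := herbrand_le w_norm u0 i_ge0 (fun t r r0 tG t1 => i_ge t r r0 tG t1).
rewrite -/G0 => h.
have B0 : 0 <= B.
  by apply: le_trans T_sum; rewrite big_seq; apply: sumr_ge0 => q; apply: T_ge0.
rewrite -(ler_pM2r G0_gt0).
apply: (le_trans h); apply: (le_trans (lerD u_le sum_i)).
have step3 : E * B <= (\dim {:K})`!%:R * B * #|G0|%:R.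
  by apply: le_trans (ler_wpM2r B0 e_le) _; rewrite mulrAC.
apply: (le_trans (lerD step3 step3)); rewrite le_eqVlt; apply/orP; left; apply/eqP.
by move: (_`!%:R) (#|_|%:R) => d g; ring.
Qed.

End FiniteLevel.

(** * The preimage fields and the theorem *)

Lemma adjoin_set_divring_closed (K : fieldType) (Kbar : closedFieldType)
    (iota : {rmorphism K -> Kbar}) (A : set Kbar) :
  GRing.divring_closed (fun z => z \in adjoin_set iota A).
Proof.
have inP z : (z \in adjoin_set iota A) <-> adjoin_set iota A z.
  by split=> [/set_mem|/mem_set].
split=> [|x y /inP hx /inP hy|x y /inP hx /inP hy]; apply/inP => S [S_div S_sub].
- by have [S1 _ _] := S_div; apply/set_mem.
- have [_ SB _] := S_div; apply/set_mem/SB; apply/mem_set; [exact: hx | exact: hy].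
- have [_ _ SV] := S_div; apply/set_mem/SV; apply/mem_set; [exact: hx | exact: hy].
Qed.

Lemma sub_adjoin_set (K : fieldType) (Kbar : closedFieldType)
    (iota : {rmorphism K -> Kbar}) (A : set Kbar) :
  range iota `|` A `<=` adjoin_set iota A.
Proof. by move=> x hx S [_]; apply. Qed.

Lemma range_divring_closed (L F : fieldType) (emb : {rmorphism L -> F}) :
  GRing.divring_closed (fun z => z \in range emb).
Proof.
split=> [|_ _ /set_mem[x _ <-] /set_mem[y _ <-]|_ _ /set_mem[x _ <-] /set_mem[y _ <-]];
  apply/mem_set.
- by exists 1; rewrite ?rmorph1.
- by exists (x - y); rewrite ?rmorphB.
- by exists (x / y); rewrite ?fmorph_div.
Qed.

Section Iterates.
Variables (K : fieldType) (Kbar : closedFieldType) (iota : {rmorphism K -> Kbar}).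
Variables (p : nat) (p_prime : prime p) (c a : K).

Local Notation f := (unicritical p (iota c)).
Local Notation F := ('X^p - c%:P : {poly K}).

Lemma horner_iter_poly n z :
  (map_poly iota (iter_poly F n)).[z] = iter n f z.
Proof.
elim: n => [|n IHn] /=; first by rewrite map_polyX hornerX.
rewrite map_comp_poly horner_comp -/(iter_poly F n) IHn.
by rewrite rmorphB rmorphXn /= map_polyX map_polyC !hornerE.
Qed.

Lemma unicritical_surj (b : Kbar) : exists z, f z = b.
Proof.
have /closed_rootP[z] : size ('X^p - (b + iota c)%:P) != 1.
  by rewrite size_XnsubC ?prime_gt0 //; case: (p) p_prime.
rewrite /root !hornerE subr_eq0 => /eqP fz.
by exists z; rewrite /unicritical fz addrK.
Qed.

Lemma iter_surj n (b : Kbar) : exists z, iter n f z = b.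
Proof.
elim: n b => [|n IHn] b; first by exists b.
by have [y <-] := unicritical_surj b; have [z <-] := IHn y; exists z.
Qed.

Lemma iter_poly_sub_neq0 n : iter_poly F n - a%:P != 0.
Proof.
apply/eqP => e; have [z hz] := iter_surj n (iota a + 1).
have := horner_iter_poly n z; move/eqP: e; rewrite subr_eq0 => /eqP ->.
rewrite map_polyC hornerC hz /= => /eqP.
by rewrite -subr_eq0 opprD addNKr oppr_eq0 oner_eq0.
Qed.

Lemma preimage_roots n (s : seq Kbar) :
    map_poly iota (iter_poly F n - a%:P) =
      lead_coef (map_poly iota (iter_poly F n - a%:P)) *: \prod_(z <- s) ('X - z%:P) ->
  forall z, iter n f z = iota a <-> z \in s.
Proof.
move=> Ds z.
have lc : lead_coef (map_poly iota (iter_poly F n - a%:P)) != 0.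
  by rewrite lead_coef_eq0 map_poly_eq0 iter_poly_sub_neq0.
have : root (map_poly iota (iter_poly F n - a%:P)) z = (z \in s).
  by rewrite Ds rootZ // root_prod_XsubC.
rewrite /root rmorphB /= map_polyC hornerD hornerN hornerC horner_iter_poly.
by rewrite subr_eq0 => <-; split=> /eqP.
Qed.

End Iterates.

Theorem theorem5p10 (R : realType) (p : nat) (p_prime : prime p)
    (Qp : fieldType) (vp : Qp -> \bar R) (Qp_def : padic_completion p vp)
    (K : fieldExtType Qp)
    (Kbar : closedFieldType) (iota : {rmorphism K -> Kbar})
    (Kbar_alg : algebraic_closure iota)
    (v : Kbar -> \bar R) (v_val : valuation v)
    (v_ext : forall x : Qp, v (iota (x%:A)) = vp x)
    (c a : K) (c_neq0 : c != 0)
    (a_distinct : forall n : nat,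
       distinct_solutions iota ('X^p - c%:P) a n)
    (v_c : v (iota c) = (- (p%:R / (p%:R - 1)))%:E) :
  exists2 w : R, 0 <= w &
    upper_ramif_lim_trivial iota
      (preimage_field_infty iota ('X^p - c%:P) a) w.
Proof.
pose f := unicritical p (iota c).
have P2 : 2 <= p%:R :> R by rewrite (ler_nat _ 2) prime_gt1.
have P1 : 0 < p%:R - 1 :> R by lra.
have v_p := valu_ext_p p_prime Qp_def v_ext.
have Kbar_char := Kbar_char0 Qp_def v_val v_ext.
have K_char0 : [pchar K] =i pred0.
  apply/pcharf0P => n; apply/eqP/eqP => [e|->//]; apply/eqP.
  rewrite -[_ == _]negbK -lt0n; apply/negP => /Kbar_char.
  by rewrite -(rmorph_nat iota) e rmorph0 eqxx.
have v_c' : v (iota c) = (- (1 + (p%:R - 1)^-1))%:E.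
  by rewrite v_c; congr (- _)%:E; field; rewrite gt_eqF.
have q0 : 0 < (p%:R - 1)^-1 :> R by rewrite invr_gt0.
have Pq : p%:R * (p%:R - 1)^-1 = 1 + (p%:R - 1)^-1 :> R.
  by field; rewrite gt_eqF.
have levels m : exists J : seq Kbar, forall z, iter m f z = iota a <-> z \in J.
  by have [s _ Ds] := a_distinct m; exists s; apply: preimage_roots.
have [m0 [B B0 hB]] := moved_pairs p_prime v_val v_p q0 Pq v_c' levels.
pose D : R := (\dim {:K})`!%:R.
have D0 : 0 <= D by rewrite ler0n.
have bound0 : 0 <= 2 * D * B by rewrite !mulr_ge0.
exists (2 * D * B + 1); first by rewrite addr_ge0.
pose E := preimage_field_infty iota ('X^p - c%:P) a.
(* The preimage field of a deep level, as a member of the inverse system that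
   absorbs all the previous levels. *)
have field_N N : exists L : finGaloisSub iota E,
    (forall k, (k <= m0 + N.+1)%N ->
       preimage_field iota ('X^p - c%:P) a k `<=` range (fgs_emb L)) /\
    exists2 w : L -> \bar R, normalized_valuation w &
      forall u (s : gal_of {:L}), 0 <= u -> s \in lower_ramif w u -> s != 1%g ->
        herbrand w u <= 2 * D * B.
  have [s s_uniq Ds] := a_distinct (m0 + N.+1)%N.
  have [L [emb [L_gal embK s_range L_min]]] := splitting_subfield K_char0 Kbar_alg
    s_uniq (iter_poly_sub_neq0 iota p_prime c a (m0 + N.+1)%N) Ds.
  have sP := preimage_roots p_prime Ds.
  have range_level m z : (m <= m0 + N.+1)%N -> iter m f z = iota a -> range emb z.
    move=> mn hz; have [y hy] := iter_surj iota p_prime c (m0 + N.+1 - m)%N z.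
    have /s_range[x _ xy] : y \in s.
      by apply/sP; rewrite -(subnKC mn) iterD hy.
    rewrite -hy -xy; elim: (m0 + N.+1 - m)%N => [|i [t _ ht]] /=; first by exists x.
    rewrite -ht; exists (t ^+ p - c%:A) => //.
    by rewrite rmorphB rmorphXn /= embK.
  have sub_E : range emb `<=` E.
    apply: (subset_trans (L_min (preimage_field iota ('X^p - c%:P) a (m0 + N.+1)%N) _ _)).
    - exact: adjoin_set_divring_closed.
    - move=> z [hz|/= zs]; apply: sub_adjoin_set; [by left | right].
      by rewrite /preimages /= horner_iter_poly; apply/sP.
    - by move=> z hz; exists (m0 + N.+1)%N => //=; rewrite addnS.
  exists (@FinGaloisSub _ _ _ _ L L_gal emb embK sub_E); split.
    move=> k kn; apply: smallest_sub; first exact: range_divring_closed.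
    move=> z [[x _ <-]|]; first by exists x%:A; rewrite ?embK.
    by rewrite /preimages /= horner_iter_poly; apply: range_level.
  have [T [T_ok T_sum T_cover]] := hB N.+1.
  apply: (herbrand_bound p_prime Qp_def v_val v_ext L_gal embK T_ok T_sum) => s1 s1_neq1 s1_inert.
  have pa := gal_partial_automorphism embK s1_inert range_level.
  case: (T_cover _ pa) => [fix_s|[t tT ht]]; last by exists t.
  case/eqP: s1_neq1; apply/eqP/gal_eqP => x _; rewrite gal_id.
  (* The elements fixed by [s1] form a field that contains the preimages. *)
  have : range emb `<=` [set emb y | y in [set y | s1 y = y]].
    apply: L_min.
      split=> [|_ _ /set_mem[y1 h1 <-] /set_mem[y2 h2 <-]|_ _ /set_mem[y1 h1 <-] /set_mem[y2 h2 <-]];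
        apply/mem_set.
      + by exists 1; rewrite /= ?rmorph1.
      + move: h1 h2 => /= h1 h2; exists (y1 - y2); last by rewrite rmorphB.
        by rewrite raddfB /= h1 h2.
      + move: h1 h2 => /= h1 h2; exists (y1 / y2); last by rewrite fmorph_div.
        by rewrite /= fmorph_div /= h1 h2.
    move=> z [[k _ <-]|/= /sP /fix_s [y yz syz]].
      by exists k%:A; rewrite ?embK //= linearZ /= rmorph1.
    by exists y => //=; apply: (fmorph_inj emb); rewrite syz.
  by move=> /(_ (emb x)) [|y /= sy /(fmorph_inj emb) <-]; first by exists x.
have embZ (M : finGaloisSub iota E) k x : fgs_emb M (k *: x) = iota k * fgs_emb M x.
  by rewrite -[k *: x]mulr_algl rmorphM fgs_embK.
move=> s; split=> [[s_compat s_upper] M|s_one].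
  have emb_basis (i : 'I_(\dim {:M})) : exists k, (1 <= k)%N /\
      preimage_field iota ('X^p - c%:P) a k (fgs_emb M (vbasis {:M})`_i).
    have [|k k1 hk] := @fgs_sub _ _ _ _ M (fgs_emb M (vbasis {:M})`_i).
      by exists (vbasis {:M})`_i.
    by exists k.
  have /choice[k hk] := emb_basis.
  have [L [L_range [w w_norm L_bound]]] := field_N (\sum_i k i)%N.
  have sub_ML : range (fgs_emb M) `<=` range (fgs_emb L).
    move=> _ [x _ <-]; rewrite (coord_vbasis (memvf x)) rmorph_sum.
    have hb (i : 'I_(\dim {:M})) : exists y, fgs_emb L y = fgs_emb M (vbasis {:M})`_i.
      have [|y _ <-] := L_range (k i) _ _ (hk i).2; last by exists y.
      by rewrite (leq_trans _ (leq_addl _ _)) // ltnW // ltnS (bigD1 i) //= leq_addr.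
    have /choice[y hy] := hb.
    exists (\sum_i coord (vbasis {:M}) i x *: y i) => //.
    rewrite rmorph_sum; apply: eq_bigr => i _.
    by rewrite !embZ hy.
  have sL : s L = 1%g.
    have := s_upper L w w_norm; rewrite inE => /asboolP[u [u0 hu su]].
    apply/eqP; apply/negPn/negP => s1.
    by have := L_bound u _ u0 su s1; rewrite hu gerDl ler10.
  apply/eqP/gal_eqP => x _; rewrite gal_id.
  have [|y _ hy] := sub_ML (fgs_emb M x); first by exists x.
  apply: (fmorph_inj (fgs_emb M)).
  by rewrite (s_compat M L sub_ML x y (esym hy)) sL gal_id hy.
(* The identity belongs to every upper ramification group, because the Herbrand
   function takes every nonnegative value. *)
split=> [M L _ x y|M w w_norm]; first by rewrite !s_one !gal_id.
rewrite s_one inE; apply/asboolP.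
have [|u u0 hu] := herbrand_surj w_norm (y := 2 * D * B + 1); first by rewrite addr_ge0.
by exists u; split=> //; apply: (group1 (lower_ramif_group w_norm u0)).
Qed.
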